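(* Let $K$ be a field and let $K \subset L$ be an étale extension of commutative rings. Then for every finite group $G$ the map of constant $G$-Tambara functors $\underline{K}^c \to \underline{L}^c$ is $G$-Tambara étale; that is, $\underline{L}^c$ is flat as a $\underline{K}^c$-module and $\Omega^{1,G}_{\underline{L}^c|\underline{K}^c}=0$.
   Context: Étale extension $K\subset L$ means that $L$ is an étale commutative $K$-algebra in the usual sense (flat and unramified; in particular $L$ is finite dimensional over $K$, and the kernel $I$ of $L\otimes_K L\to L$ satisfies $I=I^2$). Tambara functors. Let $G$ be a finite group. A $G$-Tambara functor $\underline{R}$ assigns a commutative ring $\underline{R}(X)$ to each finite $G$-set $X$ (disjoint unions are sent to products) and to each $G$-map $f\colon X \to Y$ a restriction $\underline{R}(Y)\to\underline{R}(X)$ (a ring map), a transfer $\mathsf{tr}_f\colon \underline{R}(X)\to\underline{R}(Y)$ (additive) and a norm $\mathsf{norm}_f\colon \underline{R}(X)\to\underline{R}(Y)$ (multiplicative), subject to Tambara's axioms (functoriality, base change along pullbacks, and distributivity of norms over transfers via exponential diagrams). Forgetting norms gives a commutative Green functor, i.e. a commutative monoid for the box product $\Box$ of $G$-Mackey functors. An $\underline{R}$-module is a $G$-Mackey functor with an action of this monoid. $\underline{M}\Box_{\underline{R}}\underline{N}$ is the coequalizer of $\underline{M}\Box\underline{R}\Box\underline{N}\rightrightarrows \underline{M}\Box\underline{N}$. For a map $\underline{R}\to\underline{T}$ of Tambara functors, $\underline{T}\Box_{\underline{R}}\underline{T}$ is again a Tambara functor. For a commutative ring $R$, the constant $G$-Tambara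 functor $\underline{R}^c$ has $\underline{R}^c(G/H)=R$ for all $H\leq G$, trivial Weyl actions, and for $H\leq H'\leq G$ restriction the identity, transfer $a\mapsto [H':H]a$ and norm $a\mapsto a^{[H':H]}$. The map $\underline{K}^c\to\underline{L}^c$ is the inclusion $K\subset L$ at every orbit $G/H$. Étaleness. For a map $\underline{R}\to\underline{T}$ of $G$-Tambara functors let $\underline{I}=\ker(\mathsf{mult}\colon\underline{T}\Box_{\underline{R}}\underline{T}\to\underline{T})$. Let $\underline{I}^{>1}$ be the ideal of $\underline{T}\Box_{\underline{R}}\underline{T}$ generated by all $\mathsf{norm}_f(x)$ with $x\in\underline{I}(X)$ and $f\colon X\to Y$ a $2$-surjective map of finite $G$-sets (every fibre of $f$ has at least two elements); it contains $\underline{I}^2$. The $G$-Tambara Kähler differentials are $\Omega^{1,G}_{\underline{T}|\underline{R}}=\underline{I}/\underline{I}^{>1}$. The map $\underline{R}\to\underline{T}$ is $G$-Tambara étale if $\underline{T}$ is flat over $\underline{R}$ (i.e. $\underline{T}\Box_{\underline{R}}(-)$ is exact on $\underline{R}$-modules) and $\Omega^{1,G}_{\underline{T}|\underline{R}}=0$. *)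

(* Defs.v *)
From HB Require Import structures.
From mathcomp Require Import all_boot all_fingroup all_algebra boolp.
From mathcomp.multinomials Require Import freeg.

Set Implicit Arguments.
Unset Strict Implicit.
Unset Printing Implicit Defensive.

Import GRing.Theory.
Local Open Scope quotient_scope.
Local Open Scope ring_scope.

Section Quotients.

Inductive span (V : zmodType) (S : V -> Prop) : V -> Prop :=
| span0 : span S 0
| span_gen x : S x -> span S x
| spanB x y : span S x -> span S y -> span S (x - y).

Definition span_pred (V : zmodType) (S : V -> Prop) : pred V :=
  fun x => `[< span S x >].

Lemma span_zmod_closed (V : zmodType) (S : V -> Prop) :
  zmod_closed (span_pred S).
Proof.
split=> [|x y]; first by apply/asboolP; exact: span0.
by move=> /asboolP Sx /asboolP Sy; apply/asboolP; exact: spanB.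
Qed.

HB.instance Definition _ (V : zmodType) (S : V -> Prop) :=
  GRing.isZmodClosed.Build V (span_pred S) (span_zmod_closed S).

Definition spanZ (V : zmodType) (S : V -> Prop) : zmodClosed V :=
  GRing.ZmodClosed.clone V (span_pred S) _.

Definition zquot (V : zmodType) (S : V -> Prop) : zmodType :=
  Quotient.quot (spanZ S).

Definition zpi (V : zmodType) (S : V -> Prop) (x : V) : zquot S :=
  \pi_(Quotient.quot (spanZ S)) x.

Lemma zpi_is_zmod_morphism (V : zmodType) (S : V -> Prop) :
  zmod_morphism (@zpi V S).
Proof. by move=> x y; rewrite /zpi raddfB. Qed.

HB.instance Definition _ (V : zmodType) (S : V -> Prop) :=
  GRing.isZmodMorphism.Build V (zquot S) (@zpi V S)
    (@zpi_is_zmod_morphism V S).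

Definition zrepr (V : zmodType) (S : V -> Prop) (x : zquot S) : V :=
  generic_quotient.repr (x : Quotient.quot (spanZ S)).

Lemma zreprK (V : zmodType) (S : V -> Prop) : cancel (@zrepr V S) (@zpi V S).
Proof. by move=> x; rewrite /zrepr /zpi reprK. Qed.

Lemma zpi_eq0 (V : zmodType) (S : V -> Prop) x : zpi S x = 0 <-> span S x.
Proof.
have -> : (zpi S x = 0) <-> (zpi S x = zpi S 0) by rewrite (raddf0 (zpi S)).
split=> [/eqP|Sx]; last apply/eqP; rewrite /zpi -Quotient.idealrBE subr0.
  by move/asboolP.
exact/asboolP.
Qed.

Lemma zrepr_zpi (V : zmodType) (S : V -> Prop) x :
  span S (x - zrepr (zpi S x)).
Proof. by apply/zpi_eq0; rewrite raddfB /= zreprK subrr. Qed.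

Section Lift.
Variables (V W : zmodType) (S : V -> Prop) (phi : {additive V -> W}).
Hypothesis phiS : forall x, S x -> phi x = 0.

Lemma zlift_span x : span S x -> phi x = 0.
Proof using phiS.
elim=> [|//|y z _ y0 _ z0]; first exact: raddf0.
by rewrite raddfB y0 z0 subrr.
Qed.

Definition zlift_fun of (forall x, S x -> phi x = 0) :=
  fun x : zquot S => phi (zrepr x).

Lemma zlift_funE x : zlift_fun phiS (zpi S x) = phi x.
Proof.
apply/esym/eqP; rewrite -subr_eq0 -raddfB; apply/eqP/zlift_span.
exact: zrepr_zpi.
Qed.

Lemma zlift_is_zmod_morphism : zmod_morphism (zlift_fun phiS).
Proof.
move=> x y; rewrite -[x]zreprK -[y]zreprK -(raddfB (zpi S)).
by rewrite !zlift_funE raddfB.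
Qed.

HB.instance Definition _ :=
  GRing.isZmodMorphism.Build (zquot S) W (zlift_fun phiS)
    zlift_is_zmod_morphism.

Definition zlift : {additive zquot S -> W} := zlift_fun phiS.

Lemma zliftE x : zlift (zpi S x) = phi x.
Proof. exact: zlift_funE. Qed.

End Lift.

Lemma zquot_ind (V : zmodType) (S : V -> Prop) (P : zquot S -> Prop) :
  (forall x, P (zpi S x)) -> forall x, P x.
Proof. by move=> Px x; rewrite -[x]zreprK. Qed.

End Quotients.

(* <A> modulo the subgroup generated by the elements of <A> that satisfy B; for
   subgroups A and B this is A / (A n B). *)
Section Subquotient.
Variables (V : zmodType) (A B : V -> Prop).

Definition subgrp := {x : V | span_pred A x}.
HB.instance Definition _ := [isSub of subgrp for @sval V _].
HB.instance Definition _ := [Choice of subgrp by <:].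
HB.instance Definition _ := [SubChoice_isSubZmodule of subgrp by <:].

Definition subquot : zmodType := @zquot subgrp (fun x => B (\val x)).
End Subquotient.

Section FreeAb.
Variable T : Type.

Definition freeab : zmodType := {freeg {classic T} / int}.
Definition fgen (t : T) : freeab := << (t : {classic T}) >>.

Lemma freeab_ind (P : freeab -> Prop) :
  P 0 -> (forall t, P (fgen t)) -> (forall x y, P x -> P y -> P (x - y)) ->
  forall x, P x.
Proof.
move=> P0 Pg PB x.
have PN y : P y -> P (- y) by move=> Py; rewrite -sub0r; exact: PB.
have PD y z : P y -> P z -> P (y + z).
  by move=> Py Pz; rewrite -[z]opprK; apply: PB => //; exact: PN.
have Pn y n : P y -> P (y *+ n).
  by move=> Py; elim: n => [|n IH]; rewrite ?mulr0n // mulrS; exact: PD.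
rewrite -[x]freeg_sumE; elim/big_ind: _ => // t _.
rewrite -[coeff t x]intz -freegU_mulz.
by case: (coeff t x) => n; [|apply: (PN)]; exact: Pn (Pg t).
Qed.

Definition freelift_fun (W : zmodType) (f : T -> W) : freeab -> W :=
  @fglift int (zmodule W) {classic T} f.

HB.instance Definition _ (W : zmodType) (f : T -> W) :=
  GRing.isZmodMorphism.Build freeab W (freelift_fun f)
    (@lift_is_additive int {classic T} (zmodule W) f).

Definition freelift (W : zmodType) (f : T -> W) : {additive freeab -> W} :=
  freelift_fun f.

Lemma freeliftE (W : zmodType) (f : T -> W) t : freelift f (fgen t) = f t.
Proof. by rewrite [LHS](@liftU int (zmodule W) {classic T} f 1 t) scale1r. Qed.

End FreeAb.

Definition short_exact (U V W : zmodType) (f : U -> V) (g : V -> W) : Prop :=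
  [/\ injective f,
      forall y, g y = 0 <-> exists x, f x = y
    & forall z, exists y, g y = z].

Section Tensor.
Variables (K : comPzRingType) (M N : lmodType K).

Inductive tensor_rel : freeab (M * N) -> Prop :=
| tensor_relDl x x' y :
    tensor_rel (fgen (x + x', y) - (fgen (x, y) + fgen (x', y)))
| tensor_relDr x y y' :
    tensor_rel (fgen (x, y + y') - (fgen (x, y) + fgen (x, y')))
| tensor_relZ a x y : tensor_rel (fgen (a *: x, y) - fgen (x, a *: y)).

Definition tensor : zmodType := zquot tensor_rel.
Definition tens (x : M) (y : N) : tensor := zpi tensor_rel (fgen (x, y)).

Lemma tensDl x x' y : tens (x + x') y = tens x y + tens x' y.
Proof.
apply/eqP; rewrite -subr_eq0 -!(raddfB, raddfD); apply/eqP/zpi_eq0.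
exact/span_gen/tensor_relDl.
Qed.

Lemma tensDr x y y' : tens x (y + y') = tens x y + tens x y'.
Proof.
apply/eqP; rewrite -subr_eq0 -!(raddfB, raddfD); apply/eqP/zpi_eq0.
exact/span_gen/tensor_relDr.
Qed.

Lemma tensZ a x y : tens (a *: x) y = tens x (a *: y).
Proof.
apply/eqP; rewrite -subr_eq0 -!(raddfB, raddfD); apply/eqP/zpi_eq0.
exact/span_gen/tensor_relZ.
Qed.

Lemma tensor_ind (P : tensor -> Prop) :
  P 0 -> (forall x y, P (tens x y)) -> (forall u v, P u -> P v -> P (u - v)) ->
  forall u, P u.
Proof.
move=> P0 Pt PB; apply: zquot_ind; apply: freeab_ind => [|[x y]|u v Pu Pv].
- by rewrite raddf0.
- exact: Pt.
- by rewrite raddfB; exact: PB.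
Qed.

Definition balanced (W : zmodType) (f : M -> N -> W) : Prop :=
  [/\ forall x x' y, f (x + x') y = f x y + f x' y,
      forall x y y', f x (y + y') = f x y + f x y'
    & forall a x y, f (a *: x) y = f x (a *: y)].

Section Lift.
Variables (W : zmodType) (f : M -> N -> W) (fB : balanced f).

Fact tensor_lift_rel x :
  tensor_rel x -> freelift (fun xy => f xy.1 xy.2) x = 0.
Proof.
case: fB => fDl fDr fZ; case=> *;
by rewrite !(raddfB, raddfD) /= !freeliftE /= -?opprD ?(fDl, fDr, fZ) subrr.
Qed.

Definition tensor_lift : {additive tensor -> W} := zlift tensor_lift_rel.

Lemma tensor_liftE x y : tensor_lift (tens x y) = f x y.
Proof. by rewrite [LHS]zliftE freeliftE. Qed.

End Lift.
End Tensor.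

Section TensorMap.
Variables (K : comPzRingType) (M N N' : lmodType K) (f : {linear N -> N'}).

Fact tensor_map_balanced : balanced (fun (x : M) y => tens x (f y)).
Proof.
by split=> *; rewrite ?tensDl ?linearD ?tensDr ?linearZ ?tensZ.
Qed.

Definition tensor_map : {additive tensor M N -> tensor M N'} :=
  tensor_lift tensor_map_balanced.
End TensorMap.

Section TensorAlgebra.
Variables (K : comPzRingType) (A B : comAlgType K).

Definition tensor_alg : Type := tensor A B.
HB.instance Definition _ := GRing.Zmodule.on tensor_alg.

Fact tensor_mul_balanced1 (a : A) (b : B) :
  balanced (fun c d => tens (a * c) (b * d) : tensor A B).
Proof.
by split=> *; rewrite ?mulrDr ?tensDl ?tensDr // -!scalerAr tensZ.
Qed.

Fact tensor_mul_balanced (v : tensor_alg) :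
  balanced (fun a b => tensor_lift (tensor_mul_balanced1 a b) v).
Proof.
split=> [a a' b|a b b'|k a b].
- elim/tensor_ind: v => [|c d|u v IHu IHv]; first by rewrite !raddf0 addr0.
    by rewrite !tensor_liftE mulrDl tensDl.
  by rewrite !raddfB IHu IHv opprD addrACA.
- elim/tensor_ind: v => [|c d|u v IHu IHv]; first by rewrite !raddf0 addr0.
    by rewrite !tensor_liftE mulrDl tensDr.
  by rewrite !raddfB IHu IHv opprD addrACA.
- elim/tensor_ind: v => [|c d|u v IHu IHv]; first by rewrite !raddf0.
    by rewrite !tensor_liftE -!scalerAl tensZ.
  by rewrite !raddfB IHu IHv.
Qed.

Definition tensor_one : tensor_alg := tens 1 1.
Definition tensor_mul (u v : tensor_alg) : tensor_alg :=
  tensor_lift (tensor_mul_balanced v) u.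

Lemma tensor_mulE a b c d :
  tensor_mul (tens a b) (tens c d) = tens (a * c) (b * d).
Proof. by rewrite [LHS]tensor_liftE tensor_liftE. Qed.

Fact tensor_mulBl : left_distributive tensor_mul (fun u v => u - v).
Proof. by move=> u v w; rewrite /tensor_mul raddfB. Qed.

Fact tensor_mul0l v : tensor_mul 0 v = 0.
Proof. exact: raddf0. Qed.

Fact tensor_mulBr : right_distributive tensor_mul (fun u v => u - v).
Proof.
move=> u v w; elim/tensor_ind: u => [|a b|u u' IH IH'].
- by rewrite !tensor_mul0l subr0.
- by rewrite /tensor_mul !tensor_liftE raddfB.
- by rewrite !tensor_mulBl IH IH' /= !opprD !opprK addrACA.
Qed.

Fact tensor_mul0r v : tensor_mul v 0 = 0.
Proof. by rewrite -[X in tensor_mul v X](subrr 0) tensor_mulBr subrr. Qed.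

Fact tensor_mulC : commutative tensor_mul.
Proof.
move=> u v; elim/tensor_ind: u => [|a b|u u' IH IH'].
- by rewrite tensor_mul0l tensor_mul0r.
- elim/tensor_ind: v => [|c d|v v' IH IH'].
  + by rewrite tensor_mul0l tensor_mul0r.
  + by rewrite !tensor_mulE mulrC [b * d]mulrC.
  + by rewrite tensor_mulBr tensor_mulBl IH IH'.
- by rewrite tensor_mulBl tensor_mulBr IH IH'.
Qed.

Fact tensor_mulA : associative tensor_mul.
Proof.
move=> u v w; elim/tensor_ind: u => [|a b|u u' IH IH'].
- by rewrite !tensor_mul0l.
- elim/tensor_ind: v => [|c d|v v' IH IH'].
  + by rewrite tensor_mul0l tensor_mul0r tensor_mul0l.
  + elim/tensor_ind: w => [|e f|w w' IH IH'].
    * by rewrite !tensor_mul0r.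
    * by rewrite !tensor_mulE !mulrA.
    * by rewrite !tensor_mulBr IH IH'.
  + by rewrite tensor_mulBl !tensor_mulBr tensor_mulBl IH IH'.
- by rewrite !tensor_mulBl IH IH'.
Qed.

Fact tensor_mul1l : left_id tensor_one tensor_mul.
Proof.
move=> u; elim/tensor_ind: u => [|a b|u u' IH IH'].
- by rewrite tensor_mul0r.
- by rewrite tensor_mulE !mul1r.
- by rewrite tensor_mulBr IH IH'.
Qed.

Fact tensor_mulDl : left_distributive tensor_mul +%R.
Proof. by move=> u v w; rewrite [LHS]raddfD. Qed.

HB.instance Definition _ :=
  GRing.Zmodule_isComPzRing.Build tensor_alg
    tensor_mulA tensor_mulC tensor_mul1l tensor_mulDl.

End TensorAlgebra.

Section Etale.
Variables (K : fieldType) (L : comAlgType K).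

Definition finite_type_algebra : Prop :=
  exists s : seq L, forall S : L -> Prop,
    (forall a : K, S a%:A) -> {in s, forall x, S x} ->
    (forall x y, S x -> S y -> S (x + y)) ->
    (forall x y, S x -> S y -> S (x * y)) ->
    forall x, S x.

Definition flat_algebra : Prop :=
  forall (M' M M'' : lmodType K)
    (f : {linear M' -> M}) (g : {linear M -> M''}),
  short_exact f g -> short_exact (tensor_map L f) (tensor_map L g).

Fact alg_mult_balanced : balanced (fun x y : L => x * y).
Proof. by split=> *; rewrite ?mulrDl ?mulrDr // -scalerAl -scalerAr. Qed.

Definition alg_mult : {additive tensor_alg L L -> L} :=
  tensor_lift alg_mult_balanced.

Definition alg_diag (u : tensor_alg L L) : Prop := alg_mult u = 0.

Definition alg_diag2 : tensor_alg L L -> Prop :=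
  span (fun w => exists u v, [/\ alg_diag u, alg_diag v & w = u * v]).

(* I / I^2, for I the kernel of the multiplication L (x)_K L -> L *)
Definition alg_Omega1 : zmodType := subquot alg_diag alg_diag2.

Record etale_algebra : Prop := EtaleAlgebra {
  etale_finite_type : finite_type_algebra;
  etale_flat : flat_algebra;
  etale_unramified : forall w : alg_Omega1, w = 0
}.
End Etale.

Section GSets.
Variable gT : finGroupType.

(* mathcomp actions are right actions; x |-> x g^-1 exchanges them with left
   actions, with the same equivariant maps. *)
Record gset : Type := GSet {
  gs_car :> finType;
  gs_act : {action gT &-> gs_car}
}.

Record gmap (X Y : gset) : Type := GMap {
  gm_fun :> X -> Y;
  gm_equiv : forall x a, gm_fun (gs_act X x a) = gs_act Y (gm_fun x) a
}.

Definition gid (X : gset) : gmap X X := @GMap X X id (fun x a => erefl).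

Fact gcomp_equiv (X Y Z : gset) (g : gmap Y Z) (f : gmap X Y) x a :
  g (f (gs_act X x a)) = gs_act Z (g (f x)) a.
Proof. by rewrite !gm_equiv. Qed.

Definition gcomp (X Y Z : gset) (g : gmap Y Z) (f : gmap X Y) : gmap X Z :=
  GMap (gcomp_equiv g f).

Lemma gmap_eq (X Y : gset) (f g : gmap X Y) : f =1 g -> f = g.
Proof.
case: f g => f fP [g gP] /= /funext fg; subst g.
by congr GMap; exact: Prop_irrelevance.
Qed.

Definition is_coproduct (X Y Z : gset) (i : gmap X Z) (j : gmap Y Z) : Prop :=
  bijective (fun s : X + Y => match s with inl x => i x | inr y => j y end).

(*   P --q--> Y
     |p       |g
     X --f--> Z   *)
Definition is_pullback (X Y Z P : gset) (f : gmap X Z) (g : gmap Y Z)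
    (p : gmap P X) (q : gmap P Y) : Prop :=
  (forall w, f (p w) = g (q w)) /\
  (forall x y, f x = g y -> exists! w, p w = x /\ q w = y).

(* Exponential diagram generated by A --p--> X --f--> Y:
     A <--e-- E --q--> B
     |p                |h
     X -------f------> Y
   where B is the dependent product of p along f, i.e. the set of pairs (y, s)
   of a point y of Y and a section s of p over the fibre of f at y, E is the
   pullback of f and h, and e is the evaluation map. *)
Definition is_exponential (A X Y E B : gset) (p : gmap A X) (f : gmap X Y)
    (e : gmap E A) (q : gmap E B) (h : gmap B Y) : Prop :=
  is_pullback f h (gcomp p e) q /\
  (forall (y : Y) (s : forall x, f x = y -> A),
     (forall x (fx : f x = y), p (s x fx) = x) ->
     exists! b, h b = y /\
       forall w, q w = b -> forall fx : f (p (e w)) = y, e w = s (p (e w)) fx).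

Definition two_surjective (X Y : gset) (f : gmap X Y) : Prop :=
  forall y : Y, (2 <= #|[set x | f x == y]|)%N.

Record mackey_axioms (M : gset -> zmodType)
    (res : forall X Y, gmap X Y -> M Y -> M X)
    (tr : forall X Y, gmap X Y -> M X -> M Y) : Prop := MackeyAxioms {
  max_res_id : forall X (m : M X), res X X (gid X) m = m;
  max_res_comp : forall X Y Z (g : gmap Y Z) (f : gmap X Y) m,
    res X Z (gcomp g f) m = res X Y f (res Y Z g m);
  max_tr_id : forall X (m : M X), tr X X (gid X) m = m;
  max_tr_comp : forall X Y Z (g : gmap Y Z) (f : gmap X Y) m,
    tr X Z (gcomp g f) m = tr Y Z g (tr X Y f m);
  max_base_change : forall X Y Z P (f : gmap X Z) (g : gmap Y Z)
      (p : gmap P X) (q : gmap P Y),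
    is_pullback f g p q ->
    forall m, res Y Z g (tr X Z f m) = tr P Y q (res P X p m);
  max_empty : forall X : gset, #|gs_car X| = 0%N -> forall m : M X, m = 0;
  max_coproduct : forall X Y Z (i : gmap X Z) (j : gmap Y Z),
    is_coproduct i j ->
    forall x y, exists! z, res X Z i z = x /\ res Y Z j z = y
}.

Record mackey : Type := Mackey {
  mk_obj :> gset -> zmodType;
  mk_res : forall X Y, gmap X Y -> {additive mk_obj Y -> mk_obj X};
  mk_tr : forall X Y, gmap X Y -> {additive mk_obj X -> mk_obj Y};
  mk_axioms : mackey_axioms (fun X Y => mk_res (X := X) (Y := Y))
                            (fun X Y => mk_tr (X := X) (Y := Y))
}.

Record green : Type := Green {
  gr_obj :> gset -> comPzRingType;
  gr_res : forall X Y, gmap X Y -> {rmorphism gr_obj Y -> gr_obj X};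
  gr_tr : forall X Y, gmap X Y -> {additive gr_obj X -> gr_obj Y};
  gr_axioms : @mackey_axioms (fun X => gr_obj X : zmodType)
                             (fun X Y f => gr_res f) (fun X Y f => gr_tr f);
  gr_frobenius : forall X Y (f : gmap X Y) x y,
    gr_tr f x * y = gr_tr f (x * gr_res f y)
}.

Definition mackey_of_green (R : green) : mackey :=
  @Mackey (fun X => R X : zmodType) (fun X Y f => gr_res R f)
    (fun X Y f => gr_tr R f) (gr_axioms R).

(* Values are possibly zero rings: the value at the empty G-set is zero. The
   Frobenius reciprocity of the underlying Green functor is a consequence of
   the exponential axiom; it is recorded in the structure. *)
Record tambara : Type := Tambara {
  tb_green :> green;
  tb_norm : forall X Y, gmap X Y -> tb_green X -> tb_green Y;
  tb_norm1 : forall X Y (f : gmap X Y), tb_norm f 1 = 1;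
  tb_normM : forall X Y (f : gmap X Y) x y,
    tb_norm f (x * y) = tb_norm f x * tb_norm f y;
  tb_norm_id : forall X (x : tb_green X), tb_norm (gid X) x = x;
  tb_norm_comp : forall X Y Z (g : gmap Y Z) (f : gmap X Y) x,
    tb_norm (gcomp g f) x = tb_norm g (tb_norm f x);
  tb_norm_base_change : forall X Y Z P (f : gmap X Z) (g : gmap Y Z)
      (p : gmap P X) (q : gmap P Y),
    is_pullback f g p q ->
    forall x, gr_res tb_green g (tb_norm f x) = tb_norm q (gr_res tb_green p x);
  tb_exponential : forall A X Y E B (p : gmap A X) (f : gmap X Y)
      (e : gmap E A) (q : gmap E B) (h : gmap B Y),
    is_exponential p f e q h ->
    forall a, tb_norm f (gr_tr tb_green p a) =
              gr_tr tb_green h (tb_norm q (gr_res tb_green e a))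
}.

Record tambara_hom (R T : tambara) : Type := TambaraHom {
  th_fun :> forall X, {rmorphism R X -> T X};
  th_res : forall X Y (f : gmap X Y) r,
    th_fun X (gr_res R f r) = gr_res T f (th_fun Y r);
  th_tr : forall X Y (f : gmap X Y) r,
    th_fun Y (gr_tr R f r) = gr_tr T f (th_fun X r);
  th_norm : forall X Y (f : gmap X Y) r,
    th_fun Y (tb_norm f r) = tb_norm f (th_fun X r)
}.

Definition tambara_id (T : tambara) : tambara_hom T T :=
  @TambaraHom T T (fun X => idfun) (fun X Y f r => erefl)
    (fun X Y f r => erefl) (fun X Y f r => erefl).

(* The action R [] M -> M is given by its Dress pairing R(X) x M(X) -> M(X). *)
Record gmodule (R : green) : Type := GModule {
  gm_mackey :> mackey;
  gm_act : forall X, R X -> gm_mackey X -> gm_mackey X;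
  gm_actDl : forall X (r r' : R X) m,
    gm_act (r + r') m = gm_act r m + gm_act r' m;
  gm_actDr : forall X (r : R X) m m',
    gm_act r (m + m') = gm_act r m + gm_act r m';
  gm_act1 : forall X (m : gm_mackey X), gm_act 1 m = m;
  gm_actA : forall X (r r' : R X) m, gm_act r (gm_act r' m) = gm_act (r * r') m;
  gm_act_res : forall X Y (f : gmap X Y) r m,
    mk_res gm_mackey f (gm_act r m) =
    gm_act (gr_res R f r) (mk_res gm_mackey f m);
  gm_frobenius_l : forall X Y (f : gmap X Y) r m,
    gm_act (gr_tr R f r) m = mk_tr gm_mackey f (gm_act r (mk_res gm_mackey f m));
  gm_frobenius_r : forall X Y (f : gmap X Y) r m,
    gm_act r (mk_tr gm_mackey f m) = mk_tr gm_mackey f (gm_act (gr_res R f r) m)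
}.

Record gmodule_hom (R : green) (M N : gmodule R) : Type := GModuleHom {
  gh_fun :> forall X, {additive M X -> N X};
  gh_res : forall X Y (f : gmap X Y) m,
    gh_fun X (mk_res M f m) = mk_res N f (gh_fun Y m);
  gh_tr : forall X Y (f : gmap X Y) m,
    gh_fun Y (mk_tr M f m) = mk_tr N f (gh_fun X m);
  gh_act : forall X r m, gh_fun X (gm_act r m) = gm_act r (gh_fun X m)
}.

Section TambaraModule.
Variables (R T : tambara) (phi : tambara_hom R T).

Definition tambara_mod : gmodule R.
Proof.
refine (@GModule R (mackey_of_green T) (fun X r t => phi X r * t) _ _ _ _ _ _ _).
- by move=> X r r' t; rewrite rmorphD mulrDl.
- by move=> X r t t'; rewrite mulrDr.
- by move=> X t; rewrite rmorph1 mul1r.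
- by move=> X r r' t; rewrite rmorphM mulrA.
- by move=> X Y f r t; rewrite th_res; exact: (rmorphM (gr_res T f)).
- by move=> X Y f r t; rewrite th_tr; exact: gr_frobenius.
- move=> X Y f r t; rewrite th_res.
  by have := gr_frobenius f t (phi Y r); rewrite mulrC [t * _]mulrC.
Defined.
End TambaraModule.

(* Finite G-sets carried by some {0, ..., n-1}: every finite G-set is
   isomorphic to one of them, and they form a small type. *)
Record ordgset : Type := OrdGSet {
  og_card : nat;
  og_act : {action gT &-> 'I_og_card}
}.

Definition gset_of_ord (Y : ordgset) : gset := GSet (og_act Y).
Coercion gset_of_ord : ordgset >-> gset.

Section Box.
Variables (M N : mackey) (X : gset).

(* Y --f--> X with m in M(Y), n in N(Y), standing for tr_f (m (x) n) *)
Record box_gen : Type := BoxGen {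
  bg_set : ordgset;
  bg_map : gmap bg_set X;
  bg_l : M bg_set;
  bg_r : N bg_set
}.

Inductive box_rel : freeab box_gen -> Prop :=
| box_relDl (Y : ordgset) (f : gmap Y X) m m' n :
    box_rel (fgen (BoxGen f (m + m') n) -
             (fgen (BoxGen f m n) + fgen (BoxGen f m' n)))
| box_relDr (Y : ordgset) (f : gmap Y X) m n n' :
    box_rel (fgen (BoxGen f m (n + n')) -
             (fgen (BoxGen f m n) + fgen (BoxGen f m n')))
| box_relFl (Y Z : ordgset) (f : gmap Y X) (g : gmap Z Y) m n :
    box_rel (fgen (BoxGen f (mk_tr M g m) n) -
             fgen (BoxGen (gcomp f g) m (mk_res N g n)))
| box_relFr (Y Z : ordgset) (f : gmap Y X) (g : gmap Z Y) m n :
    box_rel (fgen (BoxGen f m (mk_tr N g n)) -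
             fgen (BoxGen (gcomp f g) (mk_res M g m) n)).

(* The value at X of the box product, as the coend of M(Y) (x) N(Y) over all
   Y -> X: additivity in m and n, and Frobenius relations. *)
Definition box : zmodType := zquot box_rel.
Definition box_elt (Y : ordgset) (f : gmap Y X) (m : M Y) (n : N Y) : box :=
  zpi box_rel (fgen (BoxGen f m n)).

Record box_pairing (W : zmodType)
    (c : forall Y : ordgset, gmap Y X -> M Y -> N Y -> W) : Prop := BoxPairing {
  bp_Dl : forall (Y : ordgset) (f : gmap Y X) m m' n,
    c Y f (m + m') n = c Y f m n + c Y f m' n;
  bp_Dr : forall (Y : ordgset) (f : gmap Y X) m n n',
    c Y f m (n + n') = c Y f m n + c Y f m n';
  bp_Fl : forall (Y Z : ordgset) (f : gmap Y X) (g : gmap Z Y) m n,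
    c Y f (mk_tr M g m) n = c Z (gcomp f g) m (mk_res N g n);
  bp_Fr : forall (Y Z : ordgset) (f : gmap Y X) (g : gmap Z Y) m n,
    c Y f m (mk_tr N g n) = c Z (gcomp f g) (mk_res M g m) n
}.

Section Lift.
Variables (W : zmodType) (c : forall Y : ordgset, gmap Y X -> M Y -> N Y -> W).
Arguments c {Y}.
Hypothesis cP : box_pairing (@c).

Fact box_lift_rel x :
  box_rel x -> freelift (fun u => c (bg_map u) (bg_l u) (bg_r u)) x = 0.
Proof.
case: cP => cDl cDr cFl cFr; case=> *;
by rewrite !(raddfB, raddfD) /= !freeliftE /= -?opprD
           ?(cDl, cDr, cFl, cFr) subrr.
Qed.

Definition box_lift : {additive box -> W} := zlift box_lift_rel.

Lemma box_liftE (Y : ordgset) (f : gmap Y X) m n :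
  box_lift (box_elt f m n) = c f m n.
Proof. by rewrite [LHS]zliftE freeliftE. Qed.
End Lift.

Lemma box_eltP : box_pairing box_elt.
Proof.
by split=> *; apply/eqP; rewrite -subr_eq0 -!(raddfB, raddfD); apply/eqP;
   apply/zpi_eq0; apply: span_gen; constructor.
Qed.

Lemma box_ind (P : box -> Prop) :
  P 0 -> (forall (Y : ordgset) (f : gmap Y X) m n, P (box_elt f m n)) ->
  (forall u v, P u -> P v -> P (u - v)) -> forall u, P u.
Proof.
move=> P0 Pg PB; apply: zquot_ind; apply: freeab_ind => [|[Y f m n]|u v Pu Pv].
- by rewrite raddf0.
- exact: Pg.
- by rewrite raddfB; exact: PB.
Qed.
End Box.

Section BoxOver.
Variables (R : green) (M N : gmodule R) (X : gset).

(* Writing [] for the box product: coequalizers of Mackey functors are levelwise,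
   and (M [] R [] N)(X) is generated by the elements tr_f (m (x) r (x) n), whose
   images under the difference of the two actions are the elements below. Hence
   box_over is the coequalizer of M [] R [] N => M [] N. *)
Inductive box_balance : box M N X -> Prop :=
| box_balance_intro (Y : ordgset) (f : gmap Y X) (m : M Y) (r : R Y) (n : N Y) :
    box_balance (box_elt f (gm_act r m) n - box_elt f m (gm_act r n)).

Definition box_over : zmodType := zquot box_balance.
Definition box_over_elt (Y : ordgset) (f : gmap Y X) (m : M Y) (n : N Y) :
  box_over := zpi box_balance (box_elt f m n).

Record box_over_pairing (W : zmodType)
    (c : forall Y : ordgset, gmap Y X -> M Y -> N Y -> W) : Prop :=
  BoxOverPairing {
    bop_pairing : box_pairing c;
    bop_balanced : forall (Y : ordgset) (f : gmap Y X) (m : M Y) (r : R Y) n,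
      c Y f (gm_act r m) n = c Y f m (gm_act r n)
  }.

Section Lift.
Variables (W : zmodType) (c : forall Y : ordgset, gmap Y X -> M Y -> N Y -> W).
Hypothesis cP : box_over_pairing c.

Fact box_over_lift_rel x :
  box_balance x -> box_lift (bop_pairing cP) x = 0.
Proof.
case=> Y f m r n; rewrite raddfB; apply/eqP; rewrite subr_eq0; apply/eqP.
by rewrite !(box_liftE (bop_pairing cP)) (bop_balanced cP).
Qed.

Definition box_over_lift : {additive box_over -> W} := zlift box_over_lift_rel.

Lemma box_over_liftE (Y : ordgset) (f : gmap Y X) m n :
  box_over_lift (box_over_elt f m n) = c f m n.
Proof. by rewrite [LHS]zliftE box_liftE. Qed.
End Lift.

Lemma box_over_eltP : box_over_pairing box_over_elt.
Proof.
have [Dl Dr Fl Fr] := @box_eltP M N X.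
split; first by split=> *; rewrite /box_over_elt ?(Dl, Dr, Fl, Fr) ?raddfD.
move=> Y f m r n; apply/eqP; rewrite -subr_eq0 -raddfB; apply/eqP/zpi_eq0.
exact: span_gen.
Qed.
End BoxOver.

Section BoxOverMap.
Variables (R : green) (T M N : gmodule R) (phi : gmodule_hom M N) (X : gset).

Fact box_over_map_pairing :
  box_over_pairing (fun (Y : ordgset) (f : gmap Y X) (t : T Y) m =>
                      box_over_elt f t (phi Y m)).
Proof.
have [[Dl Dr Fl Fr] B] := @box_over_eltP R T N X.
split; first by split=> *; rewrite ?(gh_res, gh_tr) ?raddfD ?(Dl, Dr, Fl, Fr).
by move=> *; rewrite gh_act B.
Qed.

Definition box_over_map : {additive box_over T M X -> box_over T N X} :=
  box_over_lift box_over_map_pairing.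
End BoxOverMap.

(* Exactness of sequences of modules is levelwise. *)
Definition gmodule_flat (R : green) (T : gmodule R) : Prop :=
  forall (M' M M'' : gmodule R) (f : gmodule_hom M' M) (g : gmodule_hom M M''),
    (forall X, short_exact (f X) (g X)) ->
    forall X, short_exact (box_over_map T f X) (box_over_map T g X).

(* The ideal generated by S: closed under the ring operations, restrictions and
   transfers. If S is closed under norms along surjective maps, as for
   tambara_diag_gt1 below, closure under those norms is automatic. *)
Inductive green_ideal (P : green) (S : forall X, P X -> Prop) :
  forall X, P X -> Prop :=
| green_ideal_gen X x : S X x -> green_ideal S x
| green_ideal0 X : green_ideal S (0 : P X)
| green_idealB X (x y : P X) :
    green_ideal S x -> green_ideal S y -> green_ideal S (x - y)
| green_idealM X (r x : P X) : green_ideal S x -> green_ideal S (r * x)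
| green_ideal_res X Y (f : gmap X Y) (y : P Y) :
    green_ideal S y -> green_ideal S (gr_res P f y)
| green_ideal_tr X Y (f : gmap X Y) (x : P X) :
    green_ideal S x -> green_ideal S (gr_tr P f x).

Section TambaraEtale.
Variables (R T : tambara) (phi : tambara_hom R T).

Local Notation TT := (box_over (tambara_mod phi) (tambara_mod phi)).

Section Canonical.
Variables (P : tambara) (i j : tambara_hom T P).
Hypothesis ij : forall X (r : R X), i X (phi X r) = j X (phi X r).
Variable X : gset.

Fact box_can_pairing :
  @box_over_pairing R (tambara_mod phi) (tambara_mod phi) X (P X)
    (fun Y f (a b : T Y) => gr_tr P f (i Y a * j Y b)).
Proof.
have trC := max_tr_comp (gr_axioms P).
split; first split=> [Y f a a' b|Y f a b b'|Y Z f g a b|Y Z f g a b] /=.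
- by rewrite rmorphD mulrDl raddfD.
- by rewrite rmorphD mulrDr raddfD.
- by rewrite th_tr th_res gr_frobenius trC.
- by rewrite th_tr th_res mulrC gr_frobenius trC mulrC.
- by move=> Y f a r b /=; rewrite !rmorphM ij [_ * i _ a]mulrC -mulrA.
Qed.

(* tr_f (a (x) b) |-> tr_f (i(a) j(b)) *)
Definition box_can : {additive TT X -> P X} := box_over_lift box_can_pairing.
End Canonical.

(* The multiplication T []_R T -> T, tr_f (a (x) b) |-> tr_f (a b) *)
Definition box_mult (X : gset) : {additive TT X -> T X} :=
  box_can (i := tambara_id T) (j := tambara_id T) (fun X r => erefl) X.

(* T []_R T as a Tambara functor. The bijections box_can identify bt_tambara
   with T []_R T as a Mackey functor: in T []_R T the class of (f, a, b) is
   tr_f (a (x) b), which determines transfers and restrictions. The ring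
   structure and the norms are the ones for which t |-> t (x) 1 and
   t |-> 1 (x) t are maps of Tambara functors. They are unique, since every
   element of T []_R T is a sum of transfers of products (t (x) 1)(1 (x) t'). *)
Record box_tambara : Type := BoxTambara {
  bt_tambara :> tambara;
  bt_inl : tambara_hom T bt_tambara;
  bt_inr : tambara_hom T bt_tambara;
  bt_agree : forall X (r : R X), bt_inl X (phi X r) = bt_inr X (phi X r);
  bt_bij : forall X, bijective (box_can bt_agree X)
}.

Section Omega.
Variable B : box_tambara.

Definition tambara_diag (X : gset) (x : B X) : Prop :=
  exists u : TT X, box_can (@bt_agree B) X u = x /\ box_mult X u = 0.

Definition tambara_diag_gt1 : forall X : gset, B X -> Prop :=
  @green_ideal B (fun Y y => exists X (f : gmap X Y) (x : B X),
    [/\ two_surjective f, tambara_diag x & y = tb_norm f x]).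

Definition tambara_Omega (X : gset) : zmodType :=
  subquot (@tambara_diag X) (@tambara_diag_gt1 X).
End Omega.

(* te_box only makes sure that te_Omega is not vacuous: T []_R T has a unique
   structure of this kind. *)
Record tambara_etale : Prop := TambaraEtale {
  te_flat : gmodule_flat (tambara_mod phi);
  te_box : inhabited box_tambara;
  te_Omega : forall (B : box_tambara) (X : gset) (w : tambara_Omega B X), w = 0
}.
End TambaraEtale.

End GSets.

Section Constant.
Variables (gT : finGroupType) (R : comPzRingType).
Local Notation gset := (gset gT).

Definition invariant (X : gset) : pred {ffun X -> R} :=
  fun a => [forall x, forall g, a (gs_act X x g) == a x].

Lemma invariantP (X : gset) (a : {ffun X -> R}) :
  reflect (forall x g, a (gs_act X x g) = a x) (invariant a).
Proof.
apply: (iffP forallP) => [a_inv x g|a_inv x].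
  by have /forallP/(_ g)/eqP := a_inv x.
by apply/forallP => g; apply/eqP.
Qed.

Fact invariant_subring_closed (X : gset) : subring_closed (@invariant X).
Proof.
split=> [|a b /invariantP ai /invariantP bi|a b /invariantP ai /invariantP bi];
  by apply/invariantP => x g; rewrite !ffunE ?ai ?bi.
Qed.
HB.instance Definition _ (X : gset) :=
  GRing.isSubringClosed.Build {ffun X -> R} (@invariant X)
    (@invariant_subring_closed X).

(* Invariant functions X -> R; on an orbit G/H these are the constant functions,
   i.e. R, with trivial Weyl action and with identities as restrictions. *)
Section Value.
Variable X : gset.

Definition cst : Type := {a : {ffun X -> R} | invariant a}.
HB.instance Definition _ := [isSub of cst for @sval _ _].
HB.instance Definition _ := [Choice of cst by <:].
HB.instance Definition _ :=
  GRing.SubChoice_isSubPzRing.Build _ _ cst (GRing.subringClosedP _).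

Fact cst_mulC : commutative (fun a b : cst => a * b).
Proof.
by move=> a b; apply/val_inj/ffunP => x; rewrite !rmorphM !ffunE mulrC.
Qed.
HB.instance Definition _ :=
  GRing.PzRing_hasCommutativeMul.Build cst cst_mulC.
End Value.

Definition cstf (X : gset) (a : cst X) (x : X) : R := \val a x.

Lemma cst_inj (X : gset) (a b : cst X) : cstf a =1 cstf b -> a = b.
Proof. by move=> ab; apply/val_inj/ffunP. Qed.

Lemma cst_act (X : gset) (a : cst X) x g : cstf a (gs_act X x g) = cstf a x.
Proof. exact: (invariantP _ (valP a)). Qed.

Lemma cstfB X (a b : cst X) x : cstf (a - b) x = cstf a x - cstf b x.
Proof. by rewrite /cstf raddfB !ffunE. Qed.
Lemma cstfD X (a b : cst X) x : cstf (a + b) x = cstf a x + cstf b x.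
Proof. by rewrite /cstf raddfD !ffunE. Qed.
Lemma cstfM X (a b : cst X) x : cstf (a * b) x = cstf a x * cstf b x.
Proof. by rewrite /cstf rmorphM !ffunE. Qed.
Lemma cstf1 X x : cstf (1 : cst X) x = 1.
Proof. by rewrite /cstf rmorph1 !ffunE. Qed.

Definition mkcst (X : gset) (a : X -> R)
    (a_inv : forall x g, a (gs_act X x g) = a x) : cst X.
Proof.
by exists (finfun a); apply/invariantP => x g; rewrite !ffunE a_inv.
Defined.

Lemma mkcstE X a a_inv x : cstf (@mkcst X a a_inv) x = a x.
Proof. by rewrite /cstf /= ffunE. Qed.

Section Maps.
Variables (X Y : gset) (f : gmap X Y).

Fact cst_res_inv (b : cst Y) x g : cstf b (f (gs_act X x g)) = cstf b (f x).
Proof. by rewrite gm_equiv cst_act. Qed.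
Definition cst_res_fun (b : cst Y) : cst X := mkcst (cst_res_inv b).

(* the fibre of f at y is mapped bijectively to the fibre at y g *)
Lemma big_fibre_act (idx : R) (op : Monoid.com_law idx) (a : cst X) y g :
  \big[op/idx]_(x | f x == gs_act Y y g) cstf a x =
  \big[op/idx]_(x | f x == y) cstf a x.
Proof.
rewrite (reindex_inj (act_inj (gs_act X) g)) /=.
apply: eq_big => [x|x _]; last exact: cst_act.
by rewrite gm_equiv (inj_eq (act_inj (gs_act Y) g)).
Qed.

(* On orbits, f : G/H -> G/H' has fibres with [H' : H] elements, so that the
   transfer is a |-> [H' : H] a and the norm is a |-> a ^ [H' : H]. *)
Definition cst_tr_fun (a : cst X) : cst Y :=
  mkcst (fun y g => big_fibre_act +%R a y g).
Definition cst_norm (a : cst X) : cst Y :=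
  mkcst (fun y g => big_fibre_act *%R a y g).

Lemma cst_resE b x : cstf (cst_res_fun b) x = cstf b (f x).
Proof. exact: mkcstE. Qed.
Lemma cst_trE a y : cstf (cst_tr_fun a) y = \sum_(x | f x == y) cstf a x.
Proof. exact: mkcstE. Qed.
Lemma cst_normE a y : cstf (cst_norm a) y = \prod_(x | f x == y) cstf a x.
Proof. exact: mkcstE. Qed.

Fact cst_res_zmod_morphism : zmod_morphism cst_res_fun.
Proof. by move=> a b; apply: cst_inj => x; rewrite !(cst_resE, cstfB). Qed.
Fact cst_res_monoid_morphism : monoid_morphism cst_res_fun.
Proof.
by split=> [|a b]; apply: cst_inj => x; rewrite !(cst_resE, cstfM, cstf1).
Qed.
HB.instance Definition _ :=
  GRing.isZmodMorphism.Build (cst Y) (cst X) cst_res_fun cst_res_zmod_morphism.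
HB.instance Definition _ :=
  GRing.isMonoidMorphism.Build (cst Y) (cst X) cst_res_fun
    cst_res_monoid_morphism.
Definition cst_res : {rmorphism cst Y -> cst X} := cst_res_fun.

Fact cst_tr_zmod_morphism : zmod_morphism cst_tr_fun.
Proof.
move=> a b; apply: cst_inj => y; rewrite !(cst_trE, cstfB) -sumrB.
by apply: eq_bigr => x _; rewrite cstfB.
Qed.
HB.instance Definition _ :=
  GRing.isZmodMorphism.Build (cst X) (cst Y) cst_tr_fun cst_tr_zmod_morphism.
Definition cst_tr : {additive cst X -> cst Y} := cst_tr_fun.
End Maps.

Lemma big_fibre_id (idx : R) (op : Monoid.com_law idx) (X : gset) (a : cst X) y :
  \big[op/idx]_(x | gid X x == y) cstf a x = cstf a y.
Proof. by rewrite (big_pred1 y). Qed.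

Lemma big_fibre_comp (idx : R) (op : Monoid.com_law idx) (X Y Z : gset)
    (g : gmap Y Z) (f : gmap X Y) (a : cst X) z :
  \big[op/idx]_(x | gcomp g f x == z) cstf a x =
  \big[op/idx]_(y | g y == z) \big[op/idx]_(x | f x == y) cstf a x.
Proof.
rewrite (partition_big f (fun y => g y == z)) //=.
apply: eq_bigr => y /eqP gy; apply: eq_bigl => x.
by apply/andb_idl => /eqP ->; apply/eqP.
Qed.

Lemma big_fibre_pullback (idx : R) (op : Monoid.com_law idx) (X Y Z P : gset)
    (f : gmap X Z) (g : gmap Y Z) (p : gmap P X) (q : gmap P Y) (a : cst X) y :
  is_pullback f g p q ->
  \big[op/idx]_(x | f x == g y) cstf a x =
  \big[op/idx]_(w | q w == y) cstf a (p w).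
Proof.
case=> fg pq.
transitivity (\big[op/idx]_(x in p @: [set w | q w == y]) cstf a x).
  apply/eq_bigl => x; apply/eqP/imsetP => [fx|[w] ].
    by have [w [[pw qw] _]] := pq _ _ fx; exists w; rewrite // inE qw.
  by rewrite inE => /eqP <- ->.
rewrite big_imset /=; first by apply/eq_bigl => w; rewrite inE.
move=> w w'; rewrite !inE => /eqP qw /eqP qw' pw.
have [v [_ v_uniq]] : exists! v, p v = p w /\ q v = y.
  by apply: pq; rewrite fg qw.
by rewrite -(v_uniq w) // -(v_uniq w').
Qed.

Fact cst_mackey_axioms :
  @mackey_axioms gT cst (fun X Y f => cst_res f) (fun X Y f => cst_tr f).
Proof.
split.
- by move=> X a; apply: cst_inj => x; rewrite cst_resE.
- by move=> X Y Z g f a; apply: cst_inj => x; rewrite !cst_resE.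
- by move=> X a; apply: cst_inj => x; rewrite cst_trE big_fibre_id.
- move=> X Y Z g f a; apply: cst_inj => z; rewrite !cst_trE big_fibre_comp.
  by apply: eq_bigr => y _; rewrite cst_trE.
- move=> X Y Z P f g p q pb a; apply: cst_inj => y.
  rewrite cst_resE !cst_trE (big_fibre_pullback _ _ _ pb).
  by apply: eq_bigr => w _; rewrite cst_resE.
- by move=> X X0 a; apply: cst_inj => x; have := card0_eq X0 x.
- move=> X Y Z i j [s sK Ks] a b.
  pose c z := match s z with inl x => cstf a x | inr y => cstf b y end.
  have ci x : c (i x) = cstf a x by rewrite /c (sK (inl x)).
  have cj y : c (j y) = cstf b y by rewrite /c (sK (inr y)).
  have c_inv z g : c (gs_act Z z g) = c z.
    rewrite -(Ks z); case: (s z) => x.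
      by rewrite -gm_equiv !ci cst_act.
    by rewrite -gm_equiv !cj cst_act.
  exists (mkcst c_inv); split.
    by split; apply: cst_inj => x; rewrite cst_resE mkcstE.
  move=> d [da db]; apply: cst_inj => z; rewrite mkcstE -(Ks z).
  by case: (s z) => x; rewrite ?ci ?cj -?da -?db cst_resE.
Qed.

Section Exponential.
Variables (A X Y E B : gset) (p : gmap A X) (f : gmap X Y).
Variables (e : gmap E A) (q : gmap E B) (h : gmap B Y).
Hypothesis pfe : is_exponential p f e q h.

(* the section of p corresponding to b, extended by None outside of the fibre *)
Let sec (b : B) : {ffun X -> option A} :=
  [ffun x => omap e [pick w | (p (e w) == x) && (q w == b)]].
Let in_fibre (x : X) (o : option A) : bool := if o is Some a then p a == x else false.

Fact exp_square w : f (p (e w)) = h (q w).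
Proof. by have [[sq _] _] := pfe; exact: sq. Qed.

Fact exp_point x b : f x = h b -> exists! w, p (e w) = x /\ q w = b.
Proof. by have [[_ pb] _] := pfe; exact: pb. Qed.

Fact exp_inj w w' : p (e w) = p (e w') -> q w = q w' -> w = w'.
Proof.
move=> pew qw; have [v [_ v_uniq]] := exp_point (exp_square w).
by rewrite -(v_uniq w) // -(v_uniq w').
Qed.

Fact exp_secE w : sec (q w) (p (e w)) = Some (e w).
Proof.
rewrite ffunE; case: pickP => [w' /andP[/eqP pew /eqP qw]|/(_ w)].
  by rewrite (exp_inj pew qw).
by rewrite !eqxx.
Qed.

Fact exp_sec_None b x : f x != h b -> sec b x = None.
Proof.
move=> fx; rewrite ffunE; case: pickP => // w /andP[/eqP pew /eqP qw].
by rewrite -pew -qw exp_square eqxx in fx.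
Qed.

Fact exp_sec_unique y (s : {ffun X -> option A}) :
  s \in pfamily None (fun x => f x == y) in_fibre ->
  exists! b, h b = y /\ sec b = s.
Proof.
move=> /pfamilyP[s_supp s_fib].
have s_dom x : f x = y -> {a | s x = Some a & p a = x}.
  move=> fx; have := s_fib x; rewrite !unfold_in fx eqxx => /(_ isT).
  by case: (s x) => // a /eqP pa; exists a.
have [_ /(_ y (fun x fx => s2val (s_dom x fx)))] := pfe.
case=> [x fx|b [[hb eb] b_uniq]]; first by case: (s_dom x fx).
have secP b' : h b' = y -> sec b' = s ->
    forall w, q w = b' -> forall fx, e w = s2val (s_dom (p (e w)) fx).
  move=> _ sb' w qw fx.
  have sw : s (p (e w)) = Some (e w) by rewrite -sb' -qw exp_secE.
  by have [] := etrans (esym sw) (s2valP (s_dom (p (e w)) fx)).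
exists b; split=> [|b' [hb' sb']]; last first.
  by apply: b_uniq; split=> //; exact: secP.
split=> //; apply/ffunP => x; have [fx|fx] := eqVneq (f x) y.
  have [|w [[pew qw] _]] := @exp_point x b; first by rewrite hb.
  rewrite -pew -qw exp_secE; have few : f (p (e w)) = y by rewrite pew.
  by rewrite (s2valP (s_dom _ few)) -(eb w qw few).
rewrite exp_sec_None ?hb //; apply/esym/eqP; apply: contraNT fx => sx.
exact: (subsetP s_supp).
Qed.

Fact cst_exponential (a : cst A) :
  cst_norm f (cst_tr p a) = cst_tr h (cst_norm q (cst_res e a)).
Proof.
pose ev o : R := oapp (cstf a) 0 o.
apply: cst_inj => y; rewrite cst_normE cst_trE.
under eq_bigr => x _.
  rewrite cst_trE.
  have -> : \sum_(u | p u == x) cstf a u = \sum_(o | in_fibre x o) ev o.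
    transitivity (\sum_(o in Some @: [set u | p u == x]) ev o).
      rewrite big_imset /=; last by move=> ? ? _ _ [].
      by apply: eq_bigl => u; rewrite inE.
    apply: eq_bigl => o; apply/imsetP/idP => [[u + ->]|]; first by rewrite inE.
    by case: o => //= u pu; exists u; rewrite // inE.
  over.
rewrite (big_distr_big_dep None).
transitivity (\sum_(s in sec @: [set b | h b == y])
                \prod_(x | f x == y) ev (s x)).
  apply: eq_bigl => s; apply/idP/imsetP => [/exp_sec_unique|[b + ->]].
    by case=> b [[hb sb] _]; exists b; rewrite // inE hb.
  rewrite inE => /eqP hb; apply/pfamilyP; split.
    apply/subsetP => x; rewrite !unfold_in; apply: contraNT => fx.
    by rewrite exp_sec_None ?hb.
  move=> x; rewrite !unfold_in -hb => /eqP /exp_point[w [[<- <-] _]].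
  by rewrite exp_secE /=.
rewrite big_imset /=; last first.
  move=> b b'; rewrite !inE => /eqP hb /eqP hb' sbb'.
  have /exp_sec_unique[c [_ c_uniq]] :
      sec b \in pfamily None (fun x => f x == y) in_fibre.
    apply/pfamilyP; split.
      apply/subsetP => x; rewrite !unfold_in; apply: contraNT => fx.
      by rewrite exp_sec_None ?hb.
    move=> x; rewrite !unfold_in -hb => /eqP /exp_point[w [[<- <-] _]].
    by rewrite exp_secE /=.
  by rewrite -(c_uniq b) // -(c_uniq b').
apply: eq_big => [b|b]; first by rewrite inE.
rewrite inE => /eqP hb; rewrite cst_normE.
transitivity (\prod_(x in (fun w => p (e w)) @: [set w | q w == b])
                ev (sec b x)).
  apply: eq_bigl => x; apply/eqP/imsetP => [fx|[w + ->]].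
    have [|w [[pew qw] _]] := @exp_point x b; first by rewrite hb.
    by exists w; rewrite // inE qw.
  by rewrite inE => /eqP qw; rewrite exp_square qw.
rewrite big_imset /=; last first.
  by move=> w w'; rewrite !inE => /eqP qw /eqP qw' /exp_inj; apply; rewrite qw.
apply: eq_big => [w|w]; first by rewrite inE.
by rewrite inE => /eqP <-; rewrite exp_secE cst_resE.
Qed.
End Exponential.

Fact cst_frobenius (X Y : gset) (f : gmap X Y) (a : cst X) (b : cst Y) :
  cst_tr f a * b = cst_tr f (a * cst_res f b).
Proof.
apply: cst_inj => y; rewrite cstfM !cst_trE mulr_suml.
by apply: eq_bigr => x /eqP fx; rewrite cstfM cst_resE fx.
Qed.

Definition const_green : green gT :=
  @Green gT cst (fun X Y f => cst_res f) (fun X Y f => cst_tr f)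
    cst_mackey_axioms cst_frobenius.

Definition const_tambara : tambara gT.
Proof.
refine (@Tambara gT const_green (fun X Y f => cst_norm f) _ _ _ _ _ _).
- move=> X Y f; apply: cst_inj => y; rewrite cst_normE cstf1.
  by apply: big1 => x _; rewrite cstf1.
- move=> X Y f a b; apply: cst_inj => y.
  rewrite cst_normE cstfM !cst_normE -big_split.
  by apply: eq_bigr => x _; rewrite cstfM.
- by move=> X a; apply: cst_inj => x; rewrite cst_normE big_fibre_id.
- move=> X Y Z g f a; apply: cst_inj => z; rewrite !cst_normE big_fibre_comp.
  by apply: eq_bigr => y _; rewrite cst_normE.
- move=> X Y Z P f g p q pb a; apply: cst_inj => y.
  rewrite cst_resE !cst_normE (big_fibre_pullback _ _ _ pb).
  by apply: eq_bigr => w _; rewrite cst_resE.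
- by move=> A X Y E B p f e q h pfe a; exact: (cst_exponential pfe).
Defined.

End Constant.

Section ConstantHom.
Variables (gT : finGroupType) (R S : comPzRingType) (phi : {rmorphism R -> S}).

Section Value.
Variable X : gset gT.

Fact cst_map_inv (a : cst R X) (x : X) g :
  phi (cstf a (gs_act X x g)) = phi (cstf a x).
Proof. by rewrite cst_act. Qed.
Definition cst_map_fun (a : cst R X) : cst S X := mkcst (cst_map_inv a).

Lemma cst_mapE a x : cstf (cst_map_fun a) x = phi (cstf a x).
Proof. exact: mkcstE. Qed.

Fact cst_map_zmod_morphism : zmod_morphism cst_map_fun.
Proof.
by move=> a b; apply: cst_inj => x; rewrite !(cst_mapE, cstfB) rmorphB.
Qed.
Fact cst_map_monoid_morphism : monoid_morphism cst_map_fun.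
Proof.
by split=> [|a b]; apply: cst_inj => x;
   rewrite !(cst_mapE, cstfM, cstf1) (rmorph1, rmorphM).
Qed.
HB.instance Definition _ :=
  GRing.isZmodMorphism.Build (cst R X) (cst S X) cst_map_fun
    cst_map_zmod_morphism.
HB.instance Definition _ :=
  GRing.isMonoidMorphism.Build (cst R X) (cst S X) cst_map_fun
    cst_map_monoid_morphism.
Definition cst_map : {rmorphism cst R X -> cst S X} := cst_map_fun.
End Value.

Definition const_hom : tambara_hom (const_tambara gT R) (const_tambara gT S).
Proof.
refine (@TambaraHom gT (const_tambara gT R) (const_tambara gT S) cst_map _ _ _).
- move=> X Y f a; apply: cst_inj => x.
  by rewrite /= !(cst_mapE, cst_resE).
- move=> X Y f a; apply: cst_inj => y.
  rewrite /= !(cst_mapE, cst_trE) rmorph_sum.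
  by apply: eq_bigr => x _; rewrite cst_mapE.
- move=> X Y f a; apply: cst_inj => y.
  rewrite /= !(cst_mapE, cst_normE) rmorph_prod.
  by apply: eq_bigr => x _; rewrite cst_mapE.
Defined.
End ConstantHom.

(* Main.v *)
(* Restriction along X -> G/G makes M(X) a K-module for every K^c-module M, and
   L^c [] M (over K^c) has value L (x)_K M(X) at X: an invariant function
   a : Y -> L is the sum of its constant values times indicators of orbits,
   constants are restricted from X, so by Frobenius reciprocity
   tr_f (a (x) m) is the sum of the a(y) (x) tr_f (1_y m) over the orbits of Y.
   Flatness of L^c is thus flatness of L, and L^c [] L^c is (L (x)_K L)^c.
   Let I be the kernel of L (x)_K L -> L. The kernel at X of the multiplication
   is generated by the image of I, and I = I^2 by unramifiedness, so it remains
   to see that a product x y of elements of the kernel is a norm along a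
   2-surjective map: it is the norm of (x, y) along the fold map X + X -> X. *)

Require Import Defs.
From HB Require Import structures.
From mathcomp Require Import all_boot all_fingroup all_algebra boolp.

Set Implicit Arguments.
Unset Strict Implicit.
Unset Printing Implicit Defensive.

Import GRing.Theory.
Local Open Scope ring_scope.

(** * Orbit representatives, models on ordinals, and isomorphisms of G-sets in a Mackey functor *)

Section GSets.
Variable gT : finGroupType.
Implicit Types X Y Z : gset gT.

Definition orbit_rep X (x : X) : X :=
  odflt x [pick y in orbit (gs_act X) [set: gT] x].

Lemma orbit_repP X (x : X) : exists g, orbit_rep x = gs_act X x g.
Proof.
rewrite /orbit_rep; case: pickP => [y /orbitP[g _ <-]|_]; first by exists g.
by exists 1%g; rewrite act1.
Qed.

(** The choice depends only on the orbit as a set, and the default value is never reached because an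
    orbit contains its base point. *)
Lemma orbit_rep_act X (x : X) g : orbit_rep (gs_act X x g) = orbit_rep x.
Proof.
have xg : orbit (gs_act X) [set: gT] (gs_act X x g) =
          orbit (gs_act X) [set: gT] x.
  by apply/orbit_eqP; rewrite mem_orbit ?inE.
rewrite /orbit_rep xg; case: pickP => // /(_ x).
by rewrite orbit_refl.
Qed.

Section OrdModel.
Variable X : gset gT.

Definition ord_act_fun (i : 'I_#|X|) g := enum_rank (gs_act X (enum_val i) g).
Fact ord_act_is_action : is_action [set: gT] ord_act_fun.
Proof.
split=> [g i j /enum_rank_inj/act_inj/enum_val_inj //|i g h _ _].
by rewrite /ord_act_fun enum_rankK actMin ?inE.
Qed.
(** Generators of a box product live over an [ordgset]. For a general [X], the map [ord_out X] from
    this model therefore replaces the identity of [X]. *)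
Definition ord_model : ordgset gT := OrdGSet (Action ord_act_is_action).

Fact ord_out_equiv (i : ord_model) g :
  enum_val (gs_act ord_model i g) = gs_act X (enum_val i) g.
Proof. exact: enum_rankK. Qed.
Definition ord_out : gmap ord_model X := GMap ord_out_equiv.

Fact ord_in_equiv x g :
  enum_rank (gs_act X x g) = gs_act ord_model (enum_rank x) g.
Proof. by rewrite /= /ord_act_fun enum_rankK. Qed.
Definition ord_in : gmap X ord_model := GMap (Y := ord_model) ord_in_equiv.

Lemma ord_inK : gcomp ord_out ord_in = gid X.
Proof. by apply: gmap_eq => x; exact: enum_rankK. Qed.
Lemma ord_outK : gcomp ord_in ord_out = gid ord_model.
Proof. by apply: gmap_eq => x; exact: enum_valK. Qed.
End OrdModel.

Lemma injective_pullback X Y (f : gmap X Y) :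
  injective f -> is_pullback f f (gid X) (gid X).
Proof.
move=> f_inj; split=> // x y /f_inj ->.
by exists y; split=> // w [].
Qed.

Section Isomorphism.
Variables (M : gset gT -> zmodType).
Variable res : forall X Y, gmap X Y -> {additive M Y -> M X}.
Variable tr : forall X Y, gmap X Y -> {additive M X -> M Y}.
Hypothesis MP : mackey_axioms (fun X Y f => res f) (fun X Y f => tr f).
Variables (X Y : gset gT) (f : gmap X Y) (g : gmap Y X).
Hypotheses (fK : gcomp g f = gid X) (gK : gcomp f g = gid Y).

(** Base change along the pullback square of the injective map [f] with itself, whose other two
    sides are identities. *)
Lemma res_tr_iso m : res f (tr f m) = m.
Proof using MP fK.
have f_inj : injective f.
  by apply: (can_inj (g := g)) => x; exact: (congr1 (fun h => gm_fun h x) fK).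
rewrite (max_base_change MP (injective_pullback f_inj)).
by rewrite (max_tr_id MP) (max_res_id MP).
Qed.

Lemma res_iso m : res f m = tr g m.
Proof using MP fK gK.
by rewrite -[m in LHS](max_tr_id MP) -gK (max_tr_comp MP) res_tr_iso.
Qed.

Lemma tr_res_iso m : tr f (res f m) = m.
Proof using MP fK gK.
by rewrite res_iso -(max_tr_comp MP) gK (max_tr_id MP).
Qed.
End Isomorphism.
End GSets.

(** * Invariant functions as sums of constants times indicators of orbits *)

Section ConstantFunctor.
Variables (gT : finGroupType) (R : comPzRingType).
Implicit Types X Y : gset gT.

Lemma cst_orbit_rep X (a : cst R X) x : cstf a (orbit_rep x) = cstf a x.
Proof. by have [g ->] := orbit_repP x; rewrite cst_act. Qed.

Lemma cstf0 X x : cstf (0 : cst R X) x = 0.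
Proof. by rewrite /cstf raddf0 ffunE. Qed.

Lemma cstf_sum X (I : Type) (r : seq I) (P : pred I) (F : I -> cst R X) x :
  cstf (\sum_(i <- r | P i) F i) x = \sum_(i <- r | P i) cstf (F i) x.
Proof.
by apply: (big_morph (fun a => cstf a x)) => [a b|]; rewrite ?cstfD ?cstf0.
Qed.

Definition cst_const X (r : R) : cst R X := mkcst (fun _ _ => erefl r).

Lemma cst_constE X r x : cstf (cst_const X r) x = r.
Proof. exact: mkcstE. Qed.

Lemma cst_const_res X Y (f : gmap X Y) r :
  cst_res R f (cst_const Y r) = cst_const X r.
Proof. by apply: cst_inj => x; rewrite cst_resE !cst_constE. Qed.

Lemma cst_constM X (r r' : R) :
  cst_const X (r * r') = cst_const X r * cst_const X r'.
Proof. by apply: cst_inj => x; rewrite cstfM !cst_constE. Qed.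

Fact cst_ind_inv X (x : X) y g :
  (orbit_rep (gs_act X y g) == x)%:R = (orbit_rep y == x)%:R :> R.
Proof. by rewrite orbit_rep_act. Qed.

(* the indicator function of the orbit of x if x is the chosen representative
   of its orbit, and 0 otherwise *)
Definition cst_ind X (x : X) : cst R X := mkcst (cst_ind_inv x).

Lemma cst_indE X (x y : X) : cstf (cst_ind x) y = (orbit_rep y == x)%:R.
Proof. exact: mkcstE. Qed.

(** At [y] only the summand indexed by [orbit_rep y] survives, and [a] is constant on orbits. *)
Lemma cst_decomp X (a : cst R X) :
  a = \sum_x cst_const X (cstf a x) * cst_ind x.
Proof.
apply: cst_inj => y; rewrite cstf_sum (bigD1 (orbit_rep y)) //= big1.
  by rewrite cstfM cst_constE cst_indE eqxx mulr1 addr0 cst_orbit_rep.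
by move=> x /negbTE xy; rewrite cstfM cst_indE eq_sym xy mulr0.
Qed.
End ConstantFunctor.

(** * The values of a K^c-module as K-modules *)

Section Level.
Variables (gT : finGroupType) (K : comPzRingType).
Local Notation Kc := (const_tambara gT K).

Definition level (M : gmodule Kc) (X : gset gT) : Type := M X.

Section Structure.
Variables (M : gmodule Kc) (X : gset gT).
HB.instance Definition _ := GRing.Zmodule.on (level M X).

Definition level_scale (k : K) (m : level M X) : level M X :=
  gm_act (cst_const X k : Kc X) (m : M X).

Fact level_scaleA a b m :
  level_scale a (level_scale b m) = level_scale (a * b) m.
Proof.
rewrite /level_scale gm_actA; congr gm_act.
by apply: cst_inj => x; rewrite cstfM !cst_constE.
Qed.
Fact level_scale1 : left_id 1 level_scale.
Proof.
move=> m; rewrite -[RHS]gm_act1; congr gm_act.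
by apply: cst_inj => x; rewrite cst_constE cstf1.
Qed.
Fact level_scaleDr : right_distributive level_scale +%R.
Proof. by move=> a m n; exact: gm_actDr. Qed.
Fact level_scaleDl m : {morph level_scale^~ m : a b / a + b}.
Proof.
move=> a b; rewrite -[RHS]gm_actDl; congr gm_act.
by apply: cst_inj => x; rewrite cstfD !cst_constE.
Qed.
HB.instance Definition _ :=
  GRing.Zmodule_isLmodule.Build K (level M X)
    level_scaleA level_scale1 level_scaleDr level_scaleDl.
End Structure.

Lemma level_scaleE M X k (m : level M X) :
  k *: m = gm_act (cst_const X k : Kc X) (m : M X).
Proof. by []. Qed.

Section ResTr.
Variables (M : gmodule Kc) (X Y : gset gT) (f : gmap X Y).

Definition level_res (m : level M Y) : level M X := mk_res M f m.
Fact level_res_linear : linear level_res.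
Proof.
move=> k m n; rewrite /level_res raddfD; congr (_ + _).
by rewrite [in RHS]level_scaleE -(cst_const_res f); exact: gm_act_res.
Qed.
HB.instance Definition _ :=
  GRing.isLinear.Build K _ _ _ level_res level_res_linear.

Definition level_tr (m : level M X) : level M Y := mk_tr M f m.
(** Constants restrict to constants, so Frobenius reciprocity moves a scalar through the
    transfer. *)
Fact level_tr_linear : linear level_tr.
Proof.
move=> k m n; rewrite /level_tr raddfD; congr (_ + _).
by rewrite [in LHS]level_scaleE -(cst_const_res f); exact/esym/gm_frobenius_r.
Qed.
HB.instance Definition _ :=
  GRing.isLinear.Build K _ _ _ level_tr level_tr_linear.
End ResTr.

Section Hom.
Variables (M N : gmodule Kc) (phi : gmodule_hom M N) (X : gset gT).
Definition level_hom (m : level M X) : level N X := phi X m.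
Fact level_hom_linear : linear level_hom.
Proof. by move=> k m n; rewrite /level_hom raddfD [X in X + _]gh_act. Qed.
HB.instance Definition _ :=
  GRing.isLinear.Build K _ _ _ level_hom level_hom_linear.
End Hom.
End Level.

(** * Induction and extensionality for tensor and box products *)

Section TensorSums.
Variables (K : comPzRingType) (M N : lmodType K).

Lemma tens_sumr (I : Type) (r : seq I) (P : pred I) (x : M) (F : I -> N) :
  tens x (\sum_(i <- r | P i) F i) = \sum_(i <- r | P i) tens x (F i).
Proof.
apply: (big_morph (tens x)) => [y y'|]; first exact: tensDr.
by apply: (addrI (tens x 0)); rewrite -tensDr !addr0.
Qed.

Lemma tensor_ext (W : zmodType) (f g : {additive tensor M N -> W}) :
  (forall x y, f (tens x y) = g (tens x y)) -> f =1 g.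
Proof.
move=> fg; elim/tensor_ind => [|x y|u v IHu IHv]; rewrite ?raddf0 //.
by rewrite !raddfB IHu IHv.
Qed.
End TensorSums.

Lemma box_over_ind (gT : finGroupType) (R : green gT) (M N : gmodule R)
    (X : gset gT) (P : box_over M N X -> Prop) :
  P 0 -> (forall Y (f : gmap (gset_of_ord Y) X) m n, P (box_over_elt f m n)) ->
  (forall u v, P u -> P v -> P (u - v)) -> forall u, P u.
Proof.
move=> P0 Pg PB; apply: zquot_ind; apply: box_ind => [|Y f m n|u v Pu Pv].
- by rewrite raddf0.
- exact: Pg.
- by rewrite raddfB; exact: PB.
Qed.

Lemma box_over_ext (gT : finGroupType) (R : green gT) (M N : gmodule R)
    (X : gset gT) (W : zmodType) (F G : {additive box_over M N X -> W}) :
  (forall Y (f : gmap (gset_of_ord Y) X) m n,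
     F (box_over_elt f m n) = G (box_over_elt f m n)) -> F =1 G.
Proof.
move=> FG; elim/box_over_ind => [|Y f m n|u v IHu IHv]; rewrite ?raddf0 //.
by rewrite !raddfB IHu IHv.
Qed.

(** * Base change from K^c to L^c *)

Definition ext_mod (gT : finGroupType) (K : comPzRingType) (L : comAlgType K) :
    gmodule (const_tambara gT K) :=
  tambara_mod (const_hom gT (GRing.in_alg L)).

Section BaseChange.
Variables (gT : finGroupType) (K : comPzRingType) (L : comAlgType K).
Implicit Types X Y Z : gset gT.
Local Notation Kc := (const_tambara gT K).
Local Notation Lc := (const_tambara gT L).
Local Notation phi := (const_hom gT (GRing.in_alg L)).
Local Notation Lmod := (ext_mod gT L).

Lemma const_homE X (b : Kc X) x : cstf (phi X b : cst L X) x = (cstf b x)%:A.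
Proof. exact: cst_mapE. Qed.

(** The image of l (x) b under the isomorphism of L (x)_K K^c(X) with L^c(X). Restriction, transfer
    and the K^c-action only touch the factor [b]. *)
Definition cst_scalar X (l : L) (b : Kc X) : Lc X := cst_const X l * phi X b.

Lemma cst_scalarE X l (b : Kc X) x :
  cstf (cst_scalar l b : cst L X) x = cstf b x *: l.
Proof. by rewrite cstfM cst_constE const_homE mulrC mulr_algl. Qed.

(** By [cst_decomp] the elements l (x) b, with [b] an indicator, generate L^c(X) additively.
    Additive identities on L^c thus reduce to identities on K^c. *)
Lemma cst_scalar_ind X (P : Lc X -> Prop) :
  P 0 -> (forall a b, P a -> P b -> P (a + b)) ->
  (forall l b, P (cst_scalar l b)) -> forall a, P a.
Proof.
move=> P0 PD Pl a.
have -> : a = \sum_x cst_scalar (cstf (a : cst L X) x) (cst_ind K x : Kc X).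
  rewrite [LHS]cst_decomp; apply: eq_bigr => x _; congr (_ * _).
  apply: cst_inj => y; rewrite const_homE !cst_indE.
  by case: eqP => _; rewrite ?scale1r ?scale0r.
by elim/big_ind: _.
Qed.

Lemma cst_scalar_res X Y (f : gmap X Y) l b :
  gr_res Lc f (cst_scalar l b) = cst_scalar l (gr_res Kc f b).
Proof. by apply: cst_inj => x; rewrite cst_resE !cst_scalarE cst_resE. Qed.

Lemma cst_scalar_tr X Y (f : gmap X Y) l b :
  gr_tr Lc f (cst_scalar l b) = cst_scalar l (gr_tr Kc f b).
Proof.
apply: cst_inj => y; rewrite cst_trE cst_scalarE cst_trE scaler_suml.
by apply: eq_bigr => x _; rewrite cst_scalarE.
Qed.

Lemma cst_scalar_mul X l (b r : Kc X) :
  phi X r * cst_scalar l b = cst_scalar l (r * b).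
Proof.
apply: cst_inj => x; rewrite cstfM const_homE !cst_scalarE cstfM.
by rewrite mulr_algl scalerA.
Qed.

Lemma cst_scalar1 X l : cst_scalar l 1 = cst_const X l :> cst L X.
Proof.
by apply: cst_inj => x; rewrite cst_scalarE cst_constE cstf1 scale1r.
Qed.

Section Module.
Variable M : gmodule Kc.

Lemma gm_act_suml X (I : Type) (r : seq I) (P : pred I)
    (F : I -> Kc X) (m : M X) :
  gm_act (\sum_(i <- r | P i) F i) m = \sum_(i <- r | P i) gm_act (F i) m.
Proof.
apply: (big_morph (fun b : Kc X => gm_act b m)) => [b b'|].
  exact: gm_actDl.
by apply: (addrI (gm_act (0 : Kc X) m)); rewrite -gm_actDl !addr0.
Qed.

Section Value.
Variable X : gset gT.

(* the element of L (x) M(X) corresponding to tr_f (a (x) m); as cst_ind vanishes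
   off the representatives, this is a sum over orbits *)
Definition base_split Y (f : gmap Y X) (a : Lc Y) (m : M Y) :
    tensor L (level M X) :=
  \sum_y tens (cstf (a : cst L Y) y)
              (level_tr f (gm_act (cst_ind K y : Kc Y) m : level M Y)).

(** The values of [b] lie in K, so they cross the tensor sign, and the sum over orbits recombines to
    [b]. The choice of representatives thus disappears. *)
Lemma base_split_scalar Y (f : gmap Y X) l b (m : M Y) :
  base_split f (cst_scalar l b) m =
  tens l (level_tr f (gm_act b m : level M Y)).
Proof.
rewrite /base_split.
under eq_bigr => y _ do rewrite cst_scalarE tensZ -linearZ.
rewrite -tens_sumr -linear_sum; congr (tens _ (level_tr _ _)).
rewrite [b in RHS]cst_decomp gm_act_suml; apply: eq_bigr => y _.
exact: gm_actA.
Qed.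

Lemma base_splitDl Y (f : gmap Y X) a a' (m : M Y) :
  base_split f (a + a') m = base_split f a m + base_split f a' m.
Proof.
rewrite -big_split; apply: eq_bigr => y _ /=.
by rewrite -tensDl; congr (tens _ _); exact: cstfD.
Qed.

Lemma base_split0l Y (f : gmap Y X) (m : M Y) : base_split f 0 m = 0.
Proof.
by apply: (addrI (base_split f 0 m)); rewrite -base_splitDl !addr0.
Qed.

(** On the generators l (x) b, the relations for transfers become the Frobenius laws of [M], and
    balancing becomes commutativity of K^c(Y). *)
Fact base_split_pairing :
  @box_over_pairing gT Kc Lmod M X _
    (fun (Y : ordgset gT) (f : gmap Y X) a m => base_split f a m).
Proof.
split; first split.
- by move=> Y f a a' m; exact: base_splitDl.
- move=> Y f a m m'; rewrite -big_split; apply: eq_bigr => y _ /=.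
  by rewrite -tensDr -raddfD; congr (tens _ (level_tr _ _)); exact: gm_actDr.
- move=> Y Z f g a m; elim/cst_scalar_ind: a => [|a b IHa IHb|l b].
  + by rewrite raddf0 !base_split0l.
  + by rewrite raddfD !base_splitDl IHa IHb.
  + rewrite [mk_tr _ _ _]cst_scalar_tr !base_split_scalar; congr tens.
    rewrite /level_tr [RHS](max_tr_comp (mk_axioms M)); congr (mk_tr M f _).
    exact: gm_frobenius_l.
- move=> Y Z f g a m; elim/cst_scalar_ind: a => [|a b IHa IHb|l b].
  + by rewrite raddf0 !base_split0l.
  + by rewrite raddfD !base_splitDl IHa IHb.
  + rewrite [mk_res _ _ _]cst_scalar_res !base_split_scalar; congr tens.
    rewrite /level_tr [RHS](max_tr_comp (mk_axioms M)); congr (mk_tr M f _).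
    exact: gm_frobenius_r.
- move=> Y f a r m; elim/cst_scalar_ind: a => [|a b IHa IHb|l b].
  + by rewrite [gm_act _ _]mulr0 !base_split0l.
  + by rewrite [gm_act _ _]mulrDr !base_splitDl IHa IHb.
  + rewrite [gm_act _ _ in LHS]cst_scalar_mul !base_split_scalar.
    by rewrite gm_actA mulrC.
Qed.

Definition base_of_box : {additive box_over Lmod M X -> tensor L (level M X)} :=
  box_over_lift base_split_pairing.

Fact box_of_base_balanced :
  balanced (fun (l : L) (m : level M X) =>
    box_over_elt (ord_out X) (cst_const _ l : Lmod (ord_model X))
      (mk_res M (ord_out X) m)).
Proof.
have [[Dl Dr _ _] B] := @box_over_eltP gT Kc Lmod M X.
split=> [l l' m|l m m'|k l m].
- rewrite -Dl; congr box_over_elt.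
  by apply: cst_inj => x; rewrite cstfD !cst_constE.
- by rewrite raddfD Dr.
- have -> : mk_res M (ord_out X) (k *: m) =
            gm_act (cst_const _ k : Kc (ord_model X)) (mk_res M (ord_out X) m).
    exact: (linearZ_LR (level_res (M := M) (ord_out X))).
  rewrite -B; congr box_over_elt; apply: cst_inj => x.
  by rewrite cstfM const_homE !cst_constE mulr_algl.
Qed.

(** The class of l (x) m over the identity of [X], with [l] as a constant function, written over the
    ordinal model of [X]. *)
Definition box_of_base : {additive tensor L (level M X) -> box_over Lmod M X} :=
  tensor_lift box_of_base_balanced.

Lemma box_of_baseE l m :
  box_of_base (tens l m) =
  box_over_elt (ord_out X) (cst_const _ l : Lmod (ord_model X))
    (mk_res M (ord_out X) m).
Proof. exact: tensor_liftE. Qed.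

Lemma box_of_baseK : cancel box_of_base base_of_box.
Proof.
apply: (@tensor_ext _ _ _ _ (base_of_box \o box_of_base) idfun) => l m.
transitivity (base_of_box (box_of_base (tens l m))) => //.
rewrite box_of_baseE [LHS]box_over_liftE -cst_scalar1 base_split_scalar gm_act1.
by rewrite /level_tr (tr_res_iso (mk_axioms M) (ord_outK X) (ord_inK X)).
Qed.

Lemma base_of_boxK : cancel base_of_box box_of_base.
Proof.
have [[Dl Dr Fl Fr] B] := @box_over_eltP gT Kc Lmod M X.
apply: (@box_over_ext _ _ _ _ _ _ (box_of_base \o base_of_box) idfun).
move=> Y f a m.
transitivity (box_of_base (base_split f a m)).
  by congr (box_of_base _); exact: box_over_liftE.
rewrite [RHS]/=.
have fE : gcomp (ord_out X) (gcomp (ord_in X) f) = f.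
  by apply: gmap_eq => y; rewrite /= enum_rankK.
elim/cst_scalar_ind: a => [|a b IHa IHb|l b].
- rewrite base_split0l raddf0.
  apply: (addrI (box_over_elt f (0 : Lmod Y) m)).
  by rewrite -Dl !addr0.
- by rewrite base_splitDl raddfD IHa IHb -Dl.
rewrite base_split_scalar box_of_baseE /level_tr.
(* Restriction along [ord_out X] is transfer along its inverse. The composite transfer then passes
   by [Fr] to the constant [l], which restricts to a constant, and [B] moves [b] to the left
   factor. *)
rewrite (res_iso (mk_axioms M) (ord_outK X) (ord_inK X)).
rewrite -(max_tr_comp (mk_axioms M)) Fr fE -B; congr box_over_elt.
by rewrite [LHS]mulrC; congr (_ * _); exact: cst_const_res.
Qed.
End Value.
End Module.
End BaseChange.

(** * Flatness of L^c over K^c *)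

Lemma short_exact_iso (U V W U' V' W' : zmodType)
    (f : U -> V) (g : V -> W) (f' : U' -> V') (g' : V' -> W')
    (a : U -> U') (b : V -> V') (c : {additive W -> W'}) :
  bijective a -> bijective b -> bijective c ->
  (forall x, b (f x) = f' (a x)) -> (forall y, c (g y) = g' (b y)) ->
  short_exact f' g' -> short_exact f g.
Proof.
move=> [a' aK a'K] [b' bK b'K] [c' cK c'K] bf cg [f'_inj f'g' g'_surj].
split=> [x x' fx|y|z].
- by apply/(can_inj aK)/f'_inj; rewrite -!bf fx.
- split=> [gy|[x <-]].
    have /f'g'[x fx] : g' (b y) = 0 by rewrite -cg gy raddf0.
    by exists (a' x); apply: (can_inj bK); rewrite bf a'K.
  apply: (can_inj cK); rewrite cg bf raddf0; apply/f'g'.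
  by exists (a x).
- have [y gy] := g'_surj (c z); exists (b' y).
  by apply: (can_inj cK); rewrite cg b'K.
Qed.

Lemma tensor_mapE (K : comPzRingType) (M N N' : lmodType K)
    (f : {linear N -> N'}) (x : M) y :
  tensor_map M f (tens x y) = tens x (f y).
Proof. exact: tensor_liftE. Qed.

Lemma tensor_map_id (K : comPzRingType) (M N : lmodType K)
    (f : {linear N -> N}) :
  f =1 id -> tensor_map M f =1 id.
Proof.
move=> f1; apply: (@tensor_ext _ _ _ _ (tensor_map M f) idfun) => x y.
by rewrite tensor_mapE f1.
Qed.

Lemma tensor_map_comp (K : comPzRingType) (M N N' N'' : lmodType K)
    (h : {linear N -> N''}) (g : {linear N' -> N''}) (f : {linear N -> N'}) u :
  (forall x, g (f x) = h x) ->
  tensor_map M g (tensor_map M f u) = tensor_map M h u.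
Proof.
move=> gf; elim/tensor_ind: u => [|x y|u v IHu IHv].
- by rewrite !raddf0.
- by rewrite !tensor_mapE gf.
- by rewrite !raddfB IHu IHv.
Qed.

Section Flat.
Variables (gT : finGroupType) (K : comPzRingType) (L : comAlgType K).
Local Notation Kc := (const_tambara gT K).
Local Notation Lmod := (ext_mod gT L).

Lemma base_of_box_natural (M N : gmodule Kc) (f : gmodule_hom M N) X u :
  base_of_box L N X (box_over_map Lmod f X u) =
  tensor_map L (@level_hom _ _ M N f X) (base_of_box L M X u).
Proof.
move: u; apply: (@box_over_ext _ _ _ _ _ _
  (base_of_box L N X \o box_over_map Lmod f X)
  (tensor_map L (@level_hom _ _ M N f X) \o base_of_box L M X)) => Y h a m.
transitivity (base_split h a (f Y m)).
  transitivity (base_of_box L N X (box_over_elt h (a : Lmod Y) (f Y m))).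
    by congr (base_of_box _ _ _ _); exact: box_over_liftE.
  exact: box_over_liftE.
transitivity (tensor_map L (@level_hom _ _ M N f X) (base_split h a m)).
  2: by congr (tensor_map _ _ _); exact/esym/box_over_liftE.
rewrite raddf_sum; apply: eq_bigr => y _; rewrite tensor_mapE; congr tens.
by rewrite /level_tr /level_hom gh_tr gh_act.
Qed.
End Flat.

(** An exact sequence of K^c-modules is levelwise an exact sequence of K-modules. It stays exact
    after L (x)_K -, and the natural bijections [base_of_box] carry this back to the box product. *)
Lemma const_flat (gT : finGroupType) (K : fieldType) (L : comAlgType K) :
  flat_algebra L -> gmodule_flat (tambara_mod (const_hom gT (GRing.in_alg L))).
Proof.
move=> L_flat M' M M'' f g fg X.
have bij N : bijective (base_of_box L N X).
  by exists (box_of_base L N X); [exact: base_of_boxK|exact: box_of_baseK].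
apply: (short_exact_iso (bij M') (bij M) (bij M'')).
- exact: base_of_box_natural.
- exact: base_of_box_natural.
- exact/L_flat/fg.
Qed.

(** * Products as norms *)

Section Fold.
Variable gT : finGroupType.
Implicit Types X : gset gT.

Definition empty_act (v : void) (g : gT) : void := v.
Fact empty_is_action : is_action [set: gT] empty_act.
Proof. by split=> // ? []. Qed.
Definition empty_gset : gset gT := GSet (Action empty_is_action).

Definition double_act X (bx : bool * X) g := (bx.1, gs_act X bx.2 g).
Fact double_is_action X : is_action [set: gT] (@double_act X).
Proof.
split=> [g [b x] [c y] [-> /act_inj -> //]|[b x] g h _ _].
by rewrite /double_act actMin ?inE.
Qed.
Definition double_gset X : gset gT := GSet (Action (double_is_action X)).

Definition double_in X b : gmap X (double_gset X) :=
  @GMap gT X (double_gset X) (pair b) (fun x g => erefl).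
Definition fold_map X : gmap (double_gset X) X :=
  @GMap gT (double_gset X) X snd (fun x g => erefl).

Lemma fold_two_surjective X : two_surjective (fold_map X).
Proof.
move=> x; have pair_inj : injective (fun b : bool => (b, x) : double_gset X).
  by move=> b c [].
rewrite -card_bool -(card_imset _ pair_inj); apply/subset_leq_card/subsetP.
move=> _ /imsetP[b _ ->].
by rewrite inE eqxx.
Qed.

(** [w] is the product of the norms of [x] and [y] along the two inclusions. By base change each
    norm has its argument as one component and 1 as the other. The fold map is the identity on each
    copy. *)
Lemma norm_fold (T : tambara gT) X (x y : T X) :
  exists w : T (double_gset X),
    [/\ gr_res T (double_in X true) w = x,
        gr_res T (double_in X false) w = y &
        tb_norm (fold_map X) w = x * y].
Proof.
pose ni b := tb_norm (double_in X b) : T X -> T (double_gset X).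
have res_ni b z : gr_res T (double_in X b) (ni b z) = z.
  have pb : is_pullback (double_in X b) (double_in X b) (gid X) (gid X).
    by apply: injective_pullback => x1 x2 [].
  by rewrite (tb_norm_base_change pb) tb_norm_id (max_res_id (gr_axioms T)).
have res_niN b z : gr_res T (double_in X (~~ b)) (ni b z) = 1.
  pose v : gmap empty_gset X := @GMap _ empty_gset X
    (fun v : void => match v with end) (fun v => match v with end).
  (* The two copies are disjoint, so their pullback is empty. The value of [T] there is zero, and
     the norm out of it is the norm of 1. *)
  have pb : is_pullback (double_in X b) (double_in X (~~ b)) v v.
    by split=> [[]|x1 x2 []] /esym /eqP; case: b.
  rewrite (tb_norm_base_change pb) -[RHS](tb_norm1 T v); congr tb_norm.
  have T0 := max_empty (gr_axioms T) (X := empty_gset) card_void.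
  by rewrite [LHS]T0 [RHS]T0.
have fold_ni b z : tb_norm (fold_map X) (ni b z) = z.
  rewrite -tb_norm_comp (_ : gcomp _ _ = gid X) ?tb_norm_id //.
  exact: gmap_eq.
exists (ni true x * ni false y); split.
- by rewrite rmorphM res_ni (res_niN false) mulr1.
- by rewrite rmorphM res_ni (res_niN true) mul1r.
- by rewrite tb_normM !fold_ni.
Qed.
End Fold.

(** * The canonical map of the box square, on tensors *)

Definition linear_pack (K : pzRingType) (V W : lmodType K) (f : V -> W)
    (f_linear : linear f) : {linear V -> W} :=
  HB.pack f (GRing.isLinear.Build K V W *:%R f f_linear).

Section Canonical.
Variables (gT : finGroupType) (K : comPzRingType) (L : comAlgType K).
Implicit Types X Y : gset gT.
Local Notation Kc := (const_tambara gT K).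
Local Notation Lc := (const_tambara gT L).
Local Notation phi := (const_hom gT (GRing.in_alg L)).
Local Notation Lmod := (ext_mod gT L).

Lemma level_cstf_scale X k (m : level Lmod X) x :
  cstf (k *: m : cst L X) x = k *: cstf (m : cst L X) x.
Proof. by rewrite cstfM const_homE cst_constE mulr_algl. Qed.

Fact level_ev_linear X (x : X) :
  linear (fun m : level Lmod X => cstf (m : cst L X) x).
Proof. by move=> k m n; rewrite -level_cstf_scale; exact: cstfD. Qed.
Definition level_ev X (x : X) := linear_pack (level_ev_linear x).

Fact level_scalar_linear X (b : Kc X) :
  linear (fun l : L => cst_scalar l b : level Lmod X).
Proof.
move=> k l l'; apply: cst_inj => x.
rewrite [RHS]cstfD level_cstf_scale !cst_scalarE scalerDr.
by rewrite !scalerA mulrC.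
Qed.
Definition level_scalar X (b : Kc X) := linear_pack (level_scalar_linear b).

Lemma level_ev_scalar X (b : Kc X) x u :
  tensor_map L (level_ev x) (tensor_map L (level_scalar b) u) =
  tensor_map L (cstf (b : cst K X) x \*: idfun) u.
Proof. by apply: tensor_map_comp => l; exact: cst_scalarE. Qed.

Section Target.
Variables (P : tambara gT) (i j : tambara_hom Lc P).
Hypothesis ij : forall X (r : Kc X), i X (phi X r) = j X (phi X r).

(** [box_can] read through the bijection [box_of_base], with L (x)_K L^c(X) in place of the box
    square. *)
Definition base_can X : {additive tensor L (level Lmod X) -> P X} :=
  box_can ij X \o box_of_base L Lmod X.

Lemma base_canE X l (m : Lc X) :
  base_can X (tens l (m : level Lmod X)) = i X (cst_const X l) * j X m.
Proof.
transitivity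
  (box_can ij X (box_of_base L Lmod X (tens l (m : level Lmod X)))) => //.
rewrite box_of_baseE [LHS]box_over_liftE -(cst_const_res (ord_out X)).
rewrite (th_res i) [j _ _](th_res j) -rmorphM.
exact: (tr_res_iso (gr_axioms P) (ord_outK X) (ord_inK X)).
Qed.

Lemma base_can_res X Y (f : gmap X Y) u :
  gr_res P f (base_can Y u) =
  base_can X (tensor_map L (@level_res _ _ Lmod _ _ f) u).
Proof.
move: u; apply: (@tensor_ext _ _ _ _ (gr_res P f \o base_can Y)
  (base_can X \o tensor_map L (@level_res _ _ Lmod _ _ f))) => l m.
transitivity (gr_res P f (base_can Y (tens l m))) => //.
rewrite base_canE rmorphM -!th_res cst_const_res.
rewrite -base_canE.
by congr (base_can _ _); rewrite tensor_mapE.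
Qed.

(** L (x)_K L enters P(X) through constant functions. By [base_can_constM] this map takes products
    in L (x)_K L to products in P(X). *)
Definition base_can_const X : {additive tensor L L -> P X} :=
  base_can X \o tensor_map L (level_scalar (1 : Kc X)).

Lemma base_can_constE X l l' :
  base_can_const X (tens l l') = i X (cst_const X l) * j X (cst_const X l').
Proof.
transitivity
  (base_can X (tensor_map L (level_scalar (1 : Kc X)) (tens l l'))) => //.
by rewrite tensor_mapE base_canE -(cst_scalar1 X l').
Qed.

Lemma base_can_constM X (u v : tensor_alg L L) :
  base_can_const X (u * v) = base_can_const X u * base_can_const X v.
Proof.
elim/tensor_ind: u => [|a b|u u' IHu IHu'].
- by rewrite mul0r raddf0 mul0r.
- elim/tensor_ind: v => [|c d|v v' IHv IHv'].
  + by rewrite mulr0 raddf0 mulr0.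
  + rewrite [_ * _ in LHS]tensor_mulE !base_can_constE !cst_constM !rmorphM.
    by rewrite mulrACA.
  + by rewrite mulrBr !raddfB IHv IHv' mulrBr.
- by rewrite mulrBl !raddfB IHu IHu' mulrBl.
Qed.

(** [cst_decomp] applied to the second tensor factor. The coefficients are the values of [u] at
    points of [X], so a property of these values in L (x)_K L passes to P(X). *)
Lemma base_can_decomp X u :
  base_can X u =
  \sum_x j X (cst_ind L x) * base_can_const X (tensor_map L (level_ev x) u).
Proof.
elim/tensor_ind: u => [|l m|u v IHu IHv].
- by rewrite raddf0 big1 // => x _; rewrite !raddf0 mulr0.
- rewrite base_canE [m in LHS]cst_decomp rmorph_sum mulr_sumr.
  apply: eq_bigr => x _; rewrite tensor_mapE base_can_constE rmorphM.
  by rewrite [RHS]mulrC mulrA.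
- rewrite raddfB IHu IHv -sumrB; apply: eq_bigr => x _.
  by rewrite !raddfB mulrBr.
Qed.
End Target.
End Canonical.

(** * The two inclusions into a tensor product of algebras *)

Section TensorInclusions.
Variables (K : comPzRingType) (A B : comAlgType K).

Definition tens_inl (a : A) : tensor_alg A B := tens a 1.
Definition tens_inr (b : B) : tensor_alg A B := tens 1 b.

Fact tens_inl_zmod_morphism : zmod_morphism tens_inl.
Proof.
move=> a a'; apply: (addIr (tens_inl a')).
by rewrite -[LHS]tensDl !subrK.
Qed.
Fact tens_inl_monoid_morphism : monoid_morphism tens_inl.
Proof. by split=> // a a'; rewrite [RHS]tensor_mulE mulr1. Qed.
HB.instance Definition _ :=
  GRing.isZmodMorphism.Build A (tensor_alg A B) tens_inl tens_inl_zmod_morphism.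
HB.instance Definition _ :=
  GRing.isMonoidMorphism.Build A (tensor_alg A B) tens_inl
    tens_inl_monoid_morphism.

Fact tens_inr_zmod_morphism : zmod_morphism tens_inr.
Proof.
move=> b b'; apply: (addIr (tens_inr b')).
by rewrite -[LHS]tensDr !subrK.
Qed.
Fact tens_inr_monoid_morphism : monoid_morphism tens_inr.
Proof. by split=> // b b'; rewrite [RHS]tensor_mulE mulr1. Qed.
HB.instance Definition _ :=
  GRing.isZmodMorphism.Build B (tensor_alg A B) tens_inr tens_inr_zmod_morphism.
HB.instance Definition _ :=
  GRing.isMonoidMorphism.Build B (tensor_alg A B) tens_inr
    tens_inr_monoid_morphism.
End TensorInclusions.

(** * The box square of L^c *)

Section ConstantBox.
Variables (gT : finGroupType) (K : comPzRingType) (L : comAlgType K).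
Implicit Types X Y : gset gT.
Local Notation Kc := (const_tambara gT K).
Local Notation Lc := (const_tambara gT L).
Local Notation LLc := (const_tambara gT (tensor_alg L L)).
Local Notation phi := (const_hom gT (GRing.in_alg L)).
Local Notation Lmod := (ext_mod gT L).

Definition const_inl : tambara_hom Lc LLc := const_hom gT (@tens_inl K L L).
Definition const_inr : tambara_hom Lc LLc := const_hom gT (@tens_inr K L L).

Lemma const_agree X (r : Kc X) : const_inl X (phi X r) = const_inr X (phi X r).
Proof.
apply: cst_inj => x; rewrite ![in LHS]cst_mapE ![in RHS]cst_mapE.
exact: tensZ.
Qed.

(** For the target (L (x)_K L)^c the canonical map is evaluation in the second factor. *)
Lemma const_base_canE X (u : tensor L (level Lmod X)) x :
  cstf (base_can const_agree X u : cst (tensor_alg L L) X) x =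
  tensor_map L (level_ev L x) u.
Proof.
elim/tensor_ind: u => [|l m|u v IHu IHv].
- by rewrite !raddf0 [LHS]cstf0.
- rewrite base_canE tensor_mapE [LHS]cstfM [X in X * _]cst_mapE cst_constE.
  by rewrite [X in _ * X]cst_mapE [LHS]tensor_mulE mulr1 mul1r.
- by rewrite !raddfB [LHS]cstfB IHu IHv.
Qed.

(** The value of [s] on an orbit is spread over that orbit by its indicator. Only chosen
    representatives contribute, so each orbit is counted once. *)
Definition const_base_inv X (s : LLc X) : tensor L (level Lmod X) :=
  \sum_x tensor_map L (level_scalar L (cst_ind K x : Kc X))
           (cstf (s : cst (tensor_alg L L) X) x).

Lemma const_base_invB X : zmod_morphism (@const_base_inv X).
Proof.
move=> s t; rewrite -sumrB; apply: eq_bigr => x _.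
by rewrite [X in tensor_map _ _ X]cstfB; exact: raddfB.
Qed.
HB.instance Definition _ X :=
  GRing.isZmodMorphism.Build (LLc X) (tensor L (level Lmod X))
    (@const_base_inv X) (@const_base_invB X).

Lemma const_base_canK X : cancel (base_can const_agree X) (@const_base_inv X).
Proof.
move=> u; elim/tensor_ind: u => [|l m|u v IHu IHv].
- by rewrite !raddf0.
- rewrite /const_base_inv [RHS](_ : _ = tens l (\sum_x cst_const X
    (cstf (m : cst L X) x) * cst_ind L x : level Lmod X)); last first.
    by congr tens; exact: cst_decomp.
  rewrite tens_sumr; apply: eq_bigr => x _.
  rewrite const_base_canE !tensor_mapE; congr tens.
  congr (_ * _); apply: cst_inj => y; rewrite const_homE !cst_indE.
  by case: eqP; rewrite ?scale1r ?scale0r.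
- by rewrite raddfB [LHS]const_base_invB IHu IHv.
Qed.

Lemma level_ev_ind X (x y : X) (w : tensor L L) :
  tensor_map L (level_ev L y)
    (tensor_map L (level_scalar L (cst_ind K x : Kc X)) w) =
  if x == orbit_rep y then w else 0.
Proof.
rewrite level_ev_scalar cst_indE eq_sym; case: eqP => _.
  by apply: tensor_map_id => l; exact: scale1r.
elim/tensor_ind: w => [|l l'|u v IHu IHv].
- exact: raddf0.
- rewrite tensor_mapE [X in tens l X]scale0r.
  by apply: (addrI (tens l 0)); rewrite -tensDr !addr0.
- by rewrite raddfB IHu IHv subrr.
Qed.

Lemma const_base_invK X : cancel (@const_base_inv X) (base_can const_agree X).
Proof.
move=> s; apply: cst_inj => y; rewrite const_base_canE /const_base_inv.
rewrite [LHS]raddf_sum (eq_bigr _ (fun x _ => level_ev_ind x y _)).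
rewrite -big_mkcond [LHS]big_pred1_eq.
exact: cst_orbit_rep.
Qed.

Lemma const_box_can_bij X : bijective (box_can const_agree X).
Proof.
apply: (eq_bij (f := base_can const_agree X \o base_of_box L Lmod X)).
  apply: bij_comp; first by exists (@const_base_inv X);
    [exact: const_base_canK|exact: const_base_invK].
  by exists (box_of_base L Lmod X); [exact: base_of_boxK|exact: box_of_baseK].
by move=> u; congr (box_can _ _ _); exact: base_of_boxK.
Qed.

Definition const_box : box_tambara phi := BoxTambara const_box_can_bij.
End ConstantBox.

(** * Kaehler differentials *)

Section Omega.
Variables (gT : finGroupType) (K : fieldType) (L : comAlgType K).
Implicit Types X Y : gset gT.
Local Notation Lc := (const_tambara gT L).
Local Notation phi := (const_hom gT (GRing.in_alg L)).
Local Notation Lmod := (ext_mod gT L).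

Lemma box_multE X (x : X) (u : tensor L (level Lmod X)) :
  cstf (box_mult phi X (box_of_base L Lmod X u) : cst L X) x =
  alg_mult L (tensor_map L (level_ev L x) u).
Proof.
transitivity (cstf (base_can (i := tambara_id Lc) (j := tambara_id Lc)
    (fun X r => erefl) X u : cst L X) x) => //.
elim/tensor_ind: u => [|l m|u v IHu IHv].
- by rewrite !raddf0 [LHS]cstf0.
- by rewrite base_canE tensor_mapE [RHS]tensor_liftE [LHS]cstfM cst_constE.
- by rewrite !raddfB [LHS]cstfB IHu IHv.
Qed.

Variable B : box_tambara phi.
Local Notation can := (base_can (@bt_agree _ _ _ _ B)).

Lemma base_can_inj X : injective (can X).
Proof.
exact: inj_comp (bij_inj (bt_bij B X)) (can_inj (@box_of_baseK _ _ _ _ _)).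
Qed.

(** By [box_multE] the multiplication is computed pointwise, so the kernel consists of the elements
    whose values all lie in I. *)
Lemma tambara_diagP X (z : B X) :
  tambara_diag z <->
  exists2 u, can X u = z & forall x, alg_diag (tensor_map L (level_ev L x) u).
Proof.
split=> [[u [<- u0]]|[u <- u0]].
  exists (base_of_box L Lmod X u).
    by congr (box_can _ _ _); exact: base_of_boxK.
  have can0 := etrans (congr1 (box_mult phi X) (base_of_boxK u)) u0.
  move=> x; apply: etrans (cstf0 _ x); rewrite -[in RHS]can0.
  exact/esym/box_multE.
exists (box_of_base L Lmod X u); split=> //.
by apply: cst_inj => x; rewrite box_multE [RHS]cstf0; exact: u0.
Qed.

Lemma tambara_diag_const X (s : tensor_alg L L) :
  alg_diag s -> tambara_diag (base_can_const (@bt_agree _ _ _ _ B) X s).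
Proof.
move=> s0; apply/tambara_diagP; eexists; first by [].
move=> x; rewrite level_ev_scalar tensor_map_id // => l.
by rewrite /= cstf1 scale1r.
Qed.

(** The kernel is cut out pointwise and values are compatible with restriction, so it can be tested
    on a jointly surjective family. *)
Lemma tambara_diag_local X (z : B X) :
  (forall x : X, exists Y (f : gmap Y X) y,
     f y = x /\ tambara_diag (gr_res B f z)) -> tambara_diag z.
Proof.
have [u <-] : exists u, can X u = z.
  have [c _ cK] := bt_bij B X; exists (base_of_box L Lmod X (c z)).
  by rewrite -[RHS]cK; congr (box_can _ _ _); exact: base_of_boxK.
move=> z0; apply/tambara_diagP; exists u => // x.
have [Y [f [y [<- /tambara_diagP[v]]]]] := z0 x.
(* Injectivity identifies [v] with the restriction of [u], whose value at [y] is the value of [u] at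
   [f y]. *)
rewrite base_can_res => /base_can_inj -> /(_ y).
by rewrite (tensor_map_comp (h := level_ev L (f y))) // => m; exact: cst_resE.
Qed.

Lemma tambara_diag_mul X (x y : B X) :
  tambara_diag x -> tambara_diag y -> tambara_diag_gt1 (x * y).
Proof.
move=> x0 y0; have [w [wx wy <-]] := norm_fold x y.
apply: green_ideal_gen; exists (double_gset X), (fold_map X), w; split=> //.
  exact: fold_two_surjective.
(* The two inclusions cover X + X, and the components of [w] on them are [x] and [y]. *)
apply: tambara_diag_local => -[b z]; exists X, (double_in X b), z; split=> //.
by case: b; rewrite ?wx ?wy.
Qed.

(** Vanishing of the subquotient puts [s] in the subgroup generated by the elements of I lying in
    I^2. As I^2 is itself closed under differences, it contains [s]. *)
Lemma alg_diag_diag2 (s : tensor_alg L L) :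
  (forall w : alg_Omega1 L, w = 0) -> alg_diag s -> alg_diag2 s.
Proof.
move=> L_unr s0.
have sP : span_pred (@alg_diag K L) s by apply/asboolP/span_gen.
have /zpi_eq0 : zpi (fun x : subgrp (@alg_diag K L) => alg_diag2 (\val x))
   (Sub s sP) = 0 := L_unr _.
rewrite -[s in alg_diag2 s](SubK (subgrp (@alg_diag K L)) sP).
elim=> [|//|x y _ IHx _ IHy]; first by rewrite raddf0; exact: span0.
by rewrite raddfB; exact: spanB.
Qed.

Lemma tambara_diag_gt1_const X (s : tensor_alg L L) :
  alg_diag2 s -> tambara_diag_gt1 (base_can_const (@bt_agree _ _ _ _ B) X s).
Proof.
elim=> [|_ [u [v [u0 v0 ->]]]|u v _ IHu _ IHv].
- by rewrite raddf0; exact: green_ideal0.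
- rewrite base_can_constM; apply: tambara_diag_mul; exact: tambara_diag_const.
- by rewrite raddfB; exact: green_idealB.
Qed.

Lemma green_ideal_sum (P : green gT) (S : forall X, P X -> Prop) X (I : Type)
    (r : seq I) (F : I -> P X) :
  (forall i, green_ideal S (F i)) -> green_ideal S (\sum_(i <- r) F i).
Proof.
move=> SF; elim/big_ind: _ => // [|x y Sx Sy]; first exact: green_ideal0.
rewrite -[y]opprK; apply: green_idealB => //; rewrite -sub0r.
by apply: green_idealB => //; exact: green_ideal0.
Qed.

(** [base_can_decomp] writes [z] as a combination of images of elements of I, each of which lies in
    I^2 by unramifiedness. *)
Lemma tambara_diag_sub_gt1 X (z : B X) :
  (forall w : alg_Omega1 L, w = 0) -> tambara_diag z -> tambara_diag_gt1 z.
Proof.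
move=> L_unr /tambara_diagP[u <- u0]; rewrite base_can_decomp.
apply: green_ideal_sum => x; apply: green_idealM.
exact/tambara_diag_gt1_const/alg_diag_diag2.
Qed.

Lemma const_Omega0 X (w : tambara_Omega B X) :
  (forall w : alg_Omega1 L, w = 0) -> w = 0.
Proof.
move=> L_unr; move: w; apply: zquot_ind => -[z zP].
apply/zpi_eq0/span_gen => /=.
elim: (asboolW zP) => [|x x0|x y _ IHx _ IHy].
- exact: green_ideal0.
- exact: tambara_diag_sub_gt1.
- exact: green_idealB.
Qed.
End Omega.

Theorem corollary5p2 (K : fieldType) (L : comAlgType K)
    (etale_KL : etale_algebra L) (gT : finGroupType) :
  tambara_etale (const_hom gT (GRing.in_alg L)).
Proof.
have [_ L_flat L_unr] := etale_KL.
split; first exact: const_flat.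
  by exists; exact: const_box.
by move=> B X w; exact: const_Omega0.
Qed.
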